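(* Let $n$ be a positive integer. Consider the following decision problem (Directed MinMax-Betweenness restricted to linear profiles): given a directed MinMax-profile $F$ on $[n]\cup\{0,n+1\}$ which is linear, decide whether there exists a permutation $P$ of $[n]\cup\{0,n+1\}$ (with $0$ in the first position and $n+1$ in the last position) whose directed MinMax-profile is exactly $F$. This problem can be solved in time polynomial in $n$.
   Context: $[n]=\{1,\dots,n\}$. Permutations are of $[n]\cup\{0,n+1\}$, always with $0$ at the leftmost position and $n+1$ at the rightmost position. For a permutation $P$ and $0\le t\le n$, let $\min_t$ and $\max_t$ be the minimum and maximum of the elements located on $P$ in the interval delimited by the element $t$ (included) and the element $t+1$ (included). The directed MinMax-profile of $P$ is the collection, for $0\le t\le n$, of the triples $(t,t+1,[\min_t,\max_t])$ together with the information whether $t$ is to the left or to the right of $t+1$ in $P$. A directed MinMax-profile on $[n]\cup\{0,n+1\}$ (in general) is a collection $F$ of constraints, one for each $0\le t\le n$, consisting of integers $m_t,M_t$ with $0\le m_t\le t<t+1\le M_t\le n+1$ together with a specification of whether $t$ is to the left or right of $t+1$. Such an $F$ is linear if the intervals $[m_t..M_t]=\{x\in\mathbb Z: m_t\le x\le M_t\}$, $1\le t\le n-1$, are totally ordered by inclusion. *)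

(* Defs.v *)
From mathcomp Require Import all_boot.
Set Implicit Arguments. Unset Strict Implicit. Unset Printing Implicit Defensive.

Definition is_framed_perm (n : nat) (s : seq nat) : Prop :=
  perm_eq s (iota 0 n.+2) /\ head 0 s = 0 /\ last 0 s = n.+1.

Definition pos (s : seq nat) (x : nat) : nat := index x s.

Definition segment (s : seq nat) (t : nat) : seq nat :=
  let a := minn (pos s t) (pos s t.+1) in
  let b := maxn (pos s t) (pos s t.+1) in
  take (b - a).+1 (drop a s).

Definition seg_min (s : seq nat) (t : nat) : nat :=
  foldr minn (head 0 (segment s t)) (segment s t).
Definition seg_max (s : seq nat) (t : nat) : nat :=
  foldr maxn 0 (segment s t).

(* A directed MinMax-profile: for each t, the triple (m_t, M_t, d_t) where
   d_t = true means "t is to the left of t+1". *)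
Definition profile := nat -> nat * nat * bool.

Definition profile_of (s : seq nat) : profile :=
  fun t => (seg_min s t, seg_max s t, pos s t < pos s t.+1).

Definition valid_profile (n : nat) (F : profile) : Prop :=
  forall t, t <= n -> (F t).1.1 <= t /\ t.+1 <= (F t).1.2 /\ (F t).1.2 <= n.+1.

Definition int_interval (a b : nat) : seq nat := [seq x <- iota 0 b.+1 | a <= x].

Definition linear_profile (n : nat) (F : profile) : Prop :=
  forall t u, 1 <= t <= n.-1 -> 1 <= u <= n.-1 ->
    {subset int_interval (F t).1.1 (F t).1.2 <= int_interval (F u).1.1 (F u).1.2}
    \/ {subset int_interval (F u).1.1 (F u).1.2 <= int_interval (F t).1.1 (F t).1.2}.

Definition realizable (n : nat) (F : profile) : Prop :=
  exists s, is_framed_perm n s /\ forall t, t <= n -> profile_of s t = F t.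

(* Computational model: unit-cost RAM with addition and truncated           *)
(* subtraction only (polynomially equivalent to Turing machines).           *)

Inductive instr : Type :=
| IConst of nat & nat
| IAdd of nat & nat & nat
| ISub of nat & nat & nat
| ILoad of nat & nat
| IStore of nat & nat
| IJz of nat & nat
| IHalt.

Definition program := seq instr.
Definition memory := nat -> nat.
Record state := State { pc : nat; mem : memory }.

Definition upd (m : memory) (a v : nat) : memory :=
  fun x => if x == a then v else m x.

Definition halted (p : program) (st : state) : bool :=
  if nth IHalt p (pc st) is IHalt then true else false.

Definition step (p : program) (st : state) : state :=
  let m := mem st in
  let k := (pc st).+1 in
  match nth IHalt p (pc st) with
  | IConst i c => State k (upd m i c)
  | IAdd i j l => State k (upd m i (m j + m l))
  | ISub i j l => State k (upd m i (m j - m l))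
  | ILoad i j => State k (upd m i (m (m j)))
  | IStore i j => State k (upd m (m i) (m j))
  | IJz i t => State (if m i == 0 then t else k) m
  | IHalt => st
  end.

Fixpoint run (p : program) (fuel : nat) (st : state) : option state :=
  if halted p st then Some st
  else match fuel with
       | 0 => None
       | f.+1 => run p f (step p st)
       end.

Definition init (input : seq nat) : state := State 0 (fun a => nth 0 input a).

Definition output (st : state) : bool := mem st 0 != 0.

Definition encode (n : nat) (F : profile) : seq nat :=
  n :: flatten [seq [:: (F t).1.1; (F t).1.2; nat_of_bool (F t).2] | t <- iota 0 n.+1].

(* Main.v *)
(** The RAM program saturates a relation S on {0, ..., n+1}, where S x y reads "x is at or
before y", under consequences of the profile: 0 and n+1 are extreme, m_t and M_t lie
between t and t+1, an x outside [m_t, M_t] does not separate t from t+1, and S is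
transitive.  Every realization satisfies all of this, so F is not realizable if the
saturated S identifies two distinct elements.

Conversely, if S is antisymmetric then a linear F is realizable.  Process the nested
intervals by increasing width and merge t, t+1, m_t, M_t into one class; by linearity
there is at most one new class C for each width.  An end of the interval of C which does
not belong to a class merged into C compares with the whole class in the same way, and
every other merged class is S-comparable with both ends, so S arranges the merged classes
in zones around the two ends.  Ordering recursively by zone, from the widest interval
down, makes every class contiguous: elements outside [m_t, M_t] then cannot separate t
from t+1, while the zones put m_t and M_t between them. *)
Require Import Defs.
From mathcomp Require Import all_boot.
From mathcomp Require Import zify.
Set Implicit Arguments. Unset Strict Implicit. Unset Printing Implicit Defensive.

(** A contradiction needs no error state: once n + 1 is placed before 0, the frame rule and
    transitivity relate every pair, and the total relation satisfies all the rules. Saturation from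
    the empty relation therefore always ends in a closed relation, the least one, and the single
    cell (n + 1, 0) carries the answer. Necessity comes from leastness: the positions in a
    realization form a closed relation in which this cell is empty.

    Linearity says nothing about t = 0 and t = n, so these constraints stay out of the classes, as
    do the elements 0 and n + 1. For n > 1, antisymmetry makes the interval of 1 start at 1 and that
    of n - 1 end at n; by nesting, some inner interval is exactly [1, n], and the treatment of its
    ends places 1 and n correctly against all inner elements. That settles both outer constraints.

    S is only a partial order, and even m_t and M_t may be incomparable. An arbitrary linear
    extension could break the contiguity of classes, so the order is given by numerical keys with
    one digit per width. *)

Definition low (F : profile) t := (F t).1.1.
Definition high (F : profile) t := (F t).1.2.
Definition first_end (F : profile) t := if (F t).2 then t else t.+1.
Definition second_end (F : profile) t := if (F t).2 then t.+1 else t.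

(* [S x y] means that x is at or before y; a cycle is recorded by placing n + 1 before 0. *)
Record closed (n : nat) (F : profile) (S : rel nat) : Prop := Closed {
  closed_frame : forall t, t <= n -> S 0 t.+1 /\ S t n.+1;
  closed_low : forall t, t <= n ->
    S (first_end F t) (low F t) /\ S (low F t) (second_end F t);
  closed_high : forall t, t <= n ->
    S (first_end F t) (high F t) /\ S (high F t) (second_end F t);
  closed_outside : forall t x, t <= n -> x < n.+2 -> (x < low F t) || (high F t < x) ->
    S x t = S x t.+1 /\ S t x = S t.+1 x;
  closed_trans : forall x y z, x < n.+2 -> y < n.+2 -> z < n.+2 ->
    S x y -> S y z -> S x z;
  closed_collapse : forall x y, x < n.+2 -> y < n.+2 -> x != y ->
    S x y -> S y x -> S n.+1 0 }.

Definition antisymmetric_below (N : nat) (S : rel nat) :=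
  forall x y, x < N -> y < N -> x != y -> S x y -> S y x -> False.

(** * Positions in a framed permutation *)

Section FramedPermutations.

Variables (n : nat) (s : seq nat).
Hypothesis s_framed : is_framed_perm n s.

Lemma framed_mem x : (x \in s) = (x < n.+2).
Proof. by case: s_framed => /perm_mem -> _; rewrite mem_iota. Qed.

Lemma framed_uniq : uniq s.
Proof. by case: s_framed => /perm_uniq -> _; rewrite iota_uniq. Qed.

Lemma framed_size : size s = n.+2.
Proof. by case: s_framed => /perm_size -> _; rewrite size_iota. Qed.

Lemma pos_ltn x : x < n.+2 -> pos s x < n.+2.
Proof. by rewrite -framed_mem -index_mem framed_size. Qed.

Lemma pos_inj x y : x < n.+2 -> y < n.+2 -> pos s x = pos s y -> x = y.
Proof. by rewrite -!framed_mem => xs ys e; rewrite -(nth_index 0 xs) -/(pos s x) e nth_index. Qed.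

Lemma pos0 : pos s 0 = 0.
Proof.
case: s_framed => _ [h _]; have := framed_size; rewrite /pos.
by case: s h => //= a r ->; rewrite eqxx.
Qed.

Lemma pos_last : pos s n.+1 = n.+1.
Proof.
case: s_framed => _ [_ l].
have e : nth 0 s n.+1 = n.+1 by rewrite -[RHS]l -nth_last framed_size.
by rewrite /pos -{1}e index_uniq ?framed_size ?framed_uniq.
Qed.

Lemma mem_segment t x : t <= n -> x < n.+2 ->
  (x \in segment s t) =
  (minn (pos s t) (pos s t.+1) <= pos s x <= maxn (pos s t) (pos s t.+1)).
Proof.
move=> tn xn; rewrite /segment.
set a := minn _ _; set b := maxn _ _.
have bn : b < n.+2 by rewrite gtn_max !pos_ltn //; lia.
have ab : a <= b by rewrite /a /b; lia.
have xs : x \in take a s ++ drop a s by rewrite cat_take_drop framed_mem.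
have /= := framed_uniq; rewrite -[in uniq s](cat_take_drop a s) cat_uniq => /and3P[_ /hasPn dis _].
have tk := in_take a (x := x) (s := s); rewrite framed_mem xn in tk.
have as_ : a <= size s by rewrite framed_size; lia.
case xd: (x \in drop a s).
  have := dis _ xd; rewrite tk // -leqNgt => ax.
  rewrite in_take // ltnS -(leq_add2l a) subnKC //.
  have -> : a + index x (drop a s) = pos s x.
    rewrite /pos -[in RHS](cat_take_drop a s) index_cat tk // ltnNge ax /=.
    by rewrite size_takel.
  by rewrite /= ax.
move: xs; rewrite mem_cat xd orbF tk // => xa.
have -> : (a <= pos s x) = false by rewrite leqNgt /pos xa.
by apply/negP => /mem_take; rewrite xd.
Qed.

Lemma segment_bound t x : t <= n -> x \in segment s t -> x < n.+2.
Proof. by move=> _ /mem_take/mem_drop; rewrite framed_mem. Qed.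

Lemma foldr_minn_mem z l : foldr minn z l \in z :: l.
Proof.
elim: l => [|a l IH] /=; first by rewrite mem_head.
rewrite /minn; case: ifP => _; first by rewrite !inE eqxx orbT.
by move: IH; rewrite !inE => /orP[->|->]; rewrite ?orbT.
Qed.

Lemma foldr_minn_leq z l x : x \in l -> foldr minn z l <= x.
Proof.
elim: l => [//|a l IH] /=; rewrite inE => /orP[/eqP->|/IH]; rewrite geq_min ?leqnn //.
by move=> ->; rewrite orbT.
Qed.

Lemma foldr_maxn_mem l : l != [::] -> foldr maxn 0 l \in l.
Proof.
elim: l => [//|a [|b l] IH] _; first by rewrite /= maxn0 mem_head.
rewrite [foldr _ _ _]/(maxn a (foldr maxn 0 (b :: l))) /maxn; case: ifP => _.
  by rewrite in_cons IH ?orbT.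
by rewrite mem_head.
Qed.

Lemma foldr_maxn_geq l x : x \in l -> x <= foldr maxn 0 l.
Proof.
elim: l => [//|a l IH] /=; rewrite inE => /orP[/eqP->|/IH]; rewrite leq_max ?leqnn //.
by move=> ->; rewrite orbT.
Qed.

Lemma end_in_segment t : t <= n -> t \in segment s t.
Proof. by move=> tn; rewrite mem_segment //; lia. Qed.

Lemma seg_min_mem t : t <= n -> seg_min s t \in segment s t.
Proof.
move=> /end_in_segment; rewrite /seg_min; case: (segment s t) => // a l _.
have := foldr_minn_mem (head 0 (a :: l)) (a :: l).
by rewrite in_cons => /orP[/eqP->|//]; rewrite mem_head.
Qed.

Lemma seg_max_mem t : t <= n -> seg_max s t \in segment s t.
Proof. by move=> /end_in_segment h; apply: foldr_maxn_mem; case: (segment s t) h. Qed.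

Lemma seg_minP t m : t <= n -> m \in segment s t ->
  (forall x, x \in segment s t -> m <= x) -> seg_min s t = m.
Proof.
move=> tn hm lb; apply/eqP; rewrite eqn_leq (lb _ (seg_min_mem tn)) andbT.
exact: foldr_minn_leq.
Qed.

Lemma seg_maxP t M : t <= n -> M \in segment s t ->
  (forall x, x \in segment s t -> x <= M) -> seg_max s t = M.
Proof.
move=> tn hM ub; apply/eqP; rewrite eqn_leq (ub _ (seg_max_mem tn)) /=.
exact: foldr_maxn_geq.
Qed.

(** An x outside [m_t, M_t] is not in the segment of t, so it lies on one side of both t and t + 1.
    Distinct elements have distinct positions, so the collapse rule never fires. *)
Lemma closed_pos F : (forall t, t <= n -> profile_of s t = F t) ->
  closed n F (fun x y => pos s x <= pos s y).
Proof.
move=> sF.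
have E t : t <= n -> [/\ low F t = seg_min s t, high F t = seg_max s t
    & (F t).2 = (pos s t < pos s t.+1)].
  by move=> tn; rewrite /low /high -sF.
have btw t x : t <= n -> x \in segment s t ->
    pos s (first_end F t) <= pos s x /\ pos s x <= pos s (second_end F t).
  move=> tn h; have := h; rewrite mem_segment ?(segment_bound tn h) //.
  by rewrite /first_end /second_end; have [_ _ ->] := E _ tn; case: ifP; lia.
split.
- move=> t tn; rewrite pos0 pos_last; split=> //; have := @pos_ltn t; lia.
- by move=> t tn; have [-> _ _] := E _ tn; apply: btw => //; apply: seg_min_mem.
- by move=> t tn; have [_ -> _] := E _ tn; apply: btw => //; apply: seg_max_mem.
- move=> t x tn xn out.
  have ns : x \notin segment s t.
    apply/negP => h; have := foldr_minn_leq (head 0 (segment s t)) h.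
    have := foldr_maxn_geq h; rewrite -/(seg_min s t) -/(seg_max s t).
    by move: out; have [-> -> _] := E _ tn; lia.
  by rewrite mem_segment // in ns; lia.
- by move=> x y z _ _ _; apply: leq_trans.
- move=> x y xn yn /eqP xy le1 le2; case: xy; apply: pos_inj => //; lia.
Qed.

End FramedPermutations.

(** Sorting by an injective key makes comparison of positions the same as comparison of keys, so a
    realization can be built and checked through numbers alone. The last three conditions say that
    m_t and M_t are attained in the segment of t and bound it. *)
Lemma realizable_of_key n F (k : nat -> nat) :
    (forall x y, x < n.+2 -> y < n.+2 -> k x = k y -> x = y) ->
    (forall x, x < n.+2 -> k 0 <= k x <= k n.+1) ->
    (forall t, t <= n ->
      [/\ low F t < n.+2, high F t < n.+2 &
          (k t < k t.+1) = (F t).2] /\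
      [/\ minn (k t) (k t.+1) <= k (low F t) <= maxn (k t) (k t.+1),
          minn (k t) (k t.+1) <= k (high F t) <= maxn (k t) (k t.+1) &
          forall x, x < n.+2 -> minn (k t) (k t.+1) <= k x <= maxn (k t) (k t.+1) ->
            low F t <= x <= high F t]) ->
  realizable n F.
Proof.
move=> k_inj k_ends kF; pose s := sort (relpre k leq) (iota 0 n.+2).
have s_perm : perm_eq s (iota 0 n.+2) by rewrite perm_sort.
have ms x : (x \in s) = (x < n.+2) by rewrite (perm_mem s_perm) mem_iota.
have s_size : size s = n.+2 by rewrite (perm_size s_perm) size_iota.
have s_uniq : uniq s by rewrite (perm_uniq s_perm) iota_uniq.
have s_sorted : sorted (relpre k leq) s by apply: sort_sorted => x y; apply: leq_total.
have tr : transitive (relpre k leq) by move=> x y z; apply: leq_trans.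
have posE x y : x < n.+2 -> y < n.+2 -> (pos s x <= pos s y) = (k x <= k y).
  move=> xn yn; apply/idP/idP.
    by apply: (sorted_leq_index tr _ s_sorted); rewrite ?ms // => z; apply: leqnn.
  apply: contraLR; rewrite -!ltnNge => lt.
  have := sorted_ltn_index tr s_sorted; move=> /(_ y x).
  rewrite !ms => /(_ yn xn lt) /= le; rewrite ltn_neqAle le andbT.
  by apply/eqP => /(k_inj _ _ yn xn) e; rewrite e ltnn in lt.
have posE' x y : x < n.+2 -> y < n.+2 -> (pos s x < pos s y) = (k x < k y).
  by move=> xn yn; rewrite !ltnNge posE.
have framed : is_framed_perm n s.
  split=> //; split.
    have h : head 0 s \in s by rewrite -nth0 mem_nth ?s_size.
    rewrite ms in h; apply: k_inj => //; apply/eqP; rewrite eqn_leq -posE //.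
    have [/andP[-> _]] := (k_ends _ h, k_ends); rewrite andbT /pos -nth0 index_uniq ?s_size //.
  have h : last 0 s \in s by rewrite -nth_last mem_nth ?s_size.
  rewrite ms in h; apply: k_inj => //; apply/eqP; rewrite eqn_leq.
  have /andP[_ ->] := k_ends _ h; rewrite -posE //= /pos -nth_last index_uniq ?s_size //=.
  by rewrite -ltnS -s_size index_mem ms.
exists s; split=> // t tn.
have [[ln hn dir] [kl kh ks]] := kF t tn.
have segE x : x < n.+2 -> (x \in segment s t) =
    (minn (k t) (k t.+1) <= k x <= maxn (k t) (k t.+1)).
  move=> xn; rewrite (mem_segment framed) //.
  by rewrite !geq_min !leq_max !posE //; lia.
have inb x : x \in segment s t -> low F t <= x <= high F t.
  move=> h; have xn := segment_bound framed tn h.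
  by apply: ks => //; rewrite -segE.
rewrite /profile_of posE' ?dir //; last lia.
rewrite (seg_minP framed (m := low F t) tn) ?segE //; last by move=> x /inb/andP[].
rewrite (seg_maxP framed (M := high F t) tn) ?segE //; last by move=> x /inb/andP[].
by rewrite /low /high; case: (F t) => [[]].
Qed.
(** * Realizing a closed antisymmetric relation *)

Section Order.

Variables (n : nat) (F : profile) (S : rel nat).
Hypotheses (n_gt0 : 0 < n) (F_valid : valid_profile n F) (F_linear : linear_profile n F).
Hypotheses (S_closed : closed n F S) (S_anti : antisymmetric_below n.+2 S).

Local Notation m := (low F).
Local Notation M := (high F).

(** * Boundary behaviour and nesting of the intervals *)

Lemma bounds t : t <= n -> [/\ m t <= t, t < M t & M t <= n.+1].
Proof. by move=> /F_valid []; rewrite /low /high => ? []. Qed.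

Lemma S_trans y x z : x < n.+2 -> y < n.+2 -> z < n.+2 -> S x y -> S y z -> S x z.
Proof. exact: (closed_trans S_closed). Qed.

Lemma ends_cases t : (first_end F t = t /\ second_end F t = t.+1)
  \/ (first_end F t = t.+1 /\ second_end F t = t).
Proof. by rewrite /first_end /second_end; case: ((F t).2); [left|right]. Qed.

(** If m_t were 0, then 0 would be at or after the first of t and t + 1, although the frame rule
    puts it before both; antisymmetry forbids this. The case M_t = n + 1 is symmetric. *)
Lemma inner_bounds t : 0 < t < n -> 0 < m t /\ M t <= n.
Proof.
move=> /andP[t0 tn].
have tn' : t <= n by lia.
have [b1 b2 b3] := bounds tn'.
have [l1 l2] := closed_low S_closed tn'.
have [h1 h2] := closed_high S_closed tn'.
split.
  rewrite lt0n; apply/negP => /eqP m0.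
  case: (ends_cases t) => -[E1 E2]; rewrite E1 m0 in l1.
    apply: (S_anti _ _ _ l1 _) => //; try lia.
    have := (closed_frame S_closed (t:=t.-1)); rewrite prednK //; case=> //; lia.
  apply: (S_anti _ _ _ l1 _) => //; try lia.
  by have [] := closed_frame S_closed tn'.
rewrite leqNgt; apply/negP => Mn.
have Me : M t = n.+1 by lia.
case: (ends_cases t) => -[E1 E2]; rewrite E2 Me in h2.
  apply: (S_anti _ _ _ h2 _) => //; try lia.
  by have [] := closed_frame S_closed tn.
apply: (S_anti _ _ _ h2 _) => //; try lia.
by have [] := closed_frame S_closed tn'.
Qed.

Lemma direction0 : (F 0).2.
Proof.
apply/negPn/negP => /negbTE d.
have [l1 _] := closed_low S_closed (leq0n n).
have [b1 _ _] := bounds (leq0n n).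
have [f _] := closed_frame S_closed (leq0n n).
move: l1; rewrite /first_end d; have -> : m 0 = 0 by lia.
by move=> l1; apply: (S_anti _ _ _ l1 f).
Qed.

Lemma direction_last : (F n).2.
Proof.
apply/negPn/negP => /negbTE d.
have [_ h2] := closed_high S_closed (leqnn n).
have [b1 b2 b3] := bounds (leqnn n).
have [_ f] := closed_frame S_closed (leqnn n).
move: h2; rewrite /second_end d; have -> : M n = n.+1 by lia.
move=> h2; apply: (S_anti _ _ _ h2 f) => //; lia.
Qed.

Lemma high0 : M 0 <= n.
Proof.
have [b1 b2 b3] := bounds (leq0n n).
have [_ h2] := closed_high S_closed (leq0n n).
have [_ f] := closed_frame S_closed n_gt0.
rewrite leqNgt; apply/negP => Mn; have Me : M 0 = n.+1 by lia.
move: h2; rewrite /second_end direction0 Me => h2.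
apply: (S_anti _ _ _ h2 f); lia.
Qed.

Lemma low_last : 0 < m n.
Proof.
have [l1 _] := closed_low S_closed (leqnn n).
have := @closed_frame _ _ _ S_closed n.-1; rewrite prednK // => /(_ (leq_pred n)) [f _].
rewrite lt0n; apply/negP => /eqP m0.
move: l1; rewrite /first_end direction_last m0 => l1.
apply: (S_anti _ _ _ l1 f); lia.
Qed.

Definition width t := M t - m t.

Lemma mem_int_interval a b x : (x \in int_interval a b) = (a <= x <= b).
Proof. by rewrite mem_filter mem_iota add0n ltnS leq0n. Qed.

(** Width turns the inclusion order into a number, on which the merging can recurse. In particular,
    equal widths mean equal intervals. *)
Lemma nested t u : 0 < t < n -> 0 < u < n -> width t <= width u ->
  m u <= m t /\ M t <= M u.
Proof.
move=> ht hu; rewrite /width.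
have [|b1 b2 b3] := @bounds t; first lia.
have [|c1 c2 c3] := @bounds u; first lia.
have sub v w : m v <= M v ->
    {subset int_interval (m v) (M v) <= int_interval (m w) (M w)} ->
    m w <= m v /\ M v <= M w.
  move=> le s; have := s (m v); have := s (M v).
  rewrite !mem_int_interval !leqnn le => /(_ isT) /andP[_ ->].
  by move=> /(_ isT) /andP[-> _].
have ht' : 1 <= t <= n.-1 by lia.
have hu' : 1 <= u <= n.-1 by lia.
case: (F_linear ht' hu') => /sub; rewrite -/(m _) -/(M _); lia.
Qed.

Definition corners t := [:: t; t.+1; m t; M t].

Lemma corner_inside t s : 0 < t < n -> s \in corners t -> m t <= s <= M t.
Proof.
move=> ht; have [|b1 b2 b3] := @bounds t; first lia.
by rewrite !inE => /or4P [] /eqP ->; lia.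
Qed.

Lemma inside_range t x : 0 < t < n -> m t <= x <= M t -> 0 < x <= n.
Proof. by move=> /inner_bounds; lia. Qed.

(** The outside rule equates t and t + 1 as seen from x; [m t] and [M t] lie between these two in S,
    so transitivity extends the equality to them. *)
Lemma corner_outside t s x : 0 < t < n -> s \in corners t -> x < n.+2 ->
  (x < m t) || (M t < x) -> S x s = S x t /\ S s x = S t x.
Proof.
move=> ht hs xn out.
have tn : t <= n by lia.
have [e1 e2] := closed_outside S_closed tn xn out.
have [l1 l2] := closed_low S_closed tn.
have [h1 h2] := closed_high S_closed tn.
have [b1 b2 b3] := bounds tn.
have mid c : c < n.+2 -> S (first_end F t) c -> S c (second_end F t) ->
    S x c = S x t /\ S c x = S t x.
  move=> cn; have tn2 : t < n.+2 by lia.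
  have tn3 : t.+1 < n.+2 by lia.
  case: (ends_cases t) => -[-> ->] p q; split; apply/idP/idP => r.
  - by rewrite e1; apply: S_trans r q.
  - by apply: S_trans r p.
  - by apply: S_trans p r.
  - by rewrite e2 in r; apply: S_trans q r.
  - by apply: S_trans r q.
  - by rewrite e1 in r; apply: S_trans r p.
  - by rewrite e2; apply: S_trans p r.
  - by apply: S_trans q r.
move: hs; rewrite !inE => /or4P [] /eqP -> //.
- by apply: mid => //; lia.
- by apply: mid => //; lia.
Qed.

(** * Merging elements into classes by increasing width *)

Definition touched l (rp : nat -> nat) z :=
  has (fun t => (width t == l) && (rp z \in [seq rp s | s <- corners t])) (iota 1 n.-1).

(* The classes merged at width [l] receive the fresh name [n + l]. *)
Fixpoint rep l : nat -> nat :=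
  if l is l'.+1 then fun z => if touched l (rep l') z then n + l else rep l' z else id.

Lemma touchedP l rp z :
  reflect (exists t s, [/\ 0 < t < n, width t = l, s \in corners t & rp z = rp s])
          (touched l rp z).
Proof.
apply: (iffP hasP) => [[t]|[t [s [ht hw hs e]]]].
  rewrite mem_iota => ht /andP[/eqP w /mapP [s hs e]].
  by exists t, s; split=> //; lia.
exists t; first by rewrite mem_iota; lia.
by rewrite hw eqxx e map_f.
Qed.

Lemma repS l z : rep l.+1 z = if touched l.+1 (rep l) z then n + l.+1 else rep l z.
Proof. by []. Qed.

Lemma rep_leq l z : z <= n -> rep l z <= n + l.
Proof.
move=> zn; elim: l => [|l IH]; first by rewrite addn0.
by rewrite repS; case: ifP => _ //; lia.
Qed.

Lemma rep_mono j l z w : j <= l -> rep j z = rep j w -> rep l z = rep l w.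
Proof.
move=> /subnK <-; elim: (l - j) => [//|k IH] e.
by rewrite addSn !repS /touched (IH e).
Qed.

Lemma rep_corners t l s s' : 0 < t < n -> width t <= l ->
  s \in corners t -> s' \in corners t -> rep l s = rep l s'.
Proof.
move=> ht hw hs hs'; apply: (rep_mono hw).
have [|b1 b2 b3] := @bounds t; first lia.
have : 0 < width t by rewrite /width; lia.
case E: (width t) => [|k] // _.
have tch r : r \in corners t -> touched k.+1 (rep k) r.
  by move=> hr; apply/touchedP; exists t, r.
by rewrite !repS !tch.
Qed.

(** Old names are at most n + l, so the fresh name n + l + 1 cannot coincide with the name of an
    untouched class. *)
Lemma rep_split l z w : z <= n -> w <= n ->
  rep l.+1 z = rep l.+1 w -> rep l z <> rep l w ->
  touched l.+1 (rep l) z /\ touched l.+1 (rep l) w.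
Proof.
move=> zn wn; rewrite !repS.
have := rep_leq l zn; have := rep_leq l wn.
by do 2!case: ifP => //; lia.
Qed.

(** An element joins others either as a corner of some constraint, hence inside its interval, or
    because its class was already nontrivial at a smaller width. *)
Lemma rep_inside l z w : 0 < z <= n -> 0 < w <= n -> z != w -> rep l z = rep l w ->
  exists2 t, 0 < t < n & width t <= l /\ m t <= z <= M t.
Proof.
move=> zn; elim: l w => [|l IH] w wn zw e; first by rewrite /= in e; rewrite e eqxx in zw.
case: (rep l z =P rep l w) => [e'|ne].
  by have [t ht [h1 h2]] := IH w wn zw e'; exists t => //; split=> //; lia.
have [||/touchedP [t [s [ht hw hs e']]] _] := rep_split _ _ e ne; try lia.
have inn := corner_inside ht hs.
case: (eqVneq z s) => [->|zs]; first by exists t => //; split=> //; lia.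
have [|u hu [h1 h2]] := IH s _ zs e'; first exact: inside_range ht inn.
by exists u => //; split=> //; lia.
Qed.

Lemma width_gt0 t : 0 < t < n -> 0 < width t < n.
Proof.
move=> ht; have [|b1 b2 b3] := @bounds t; first lia.
have := inner_bounds ht; rewrite /width; lia.
Qed.

(* An element that is an end of every narrow interval containing it does not
   separate the elements of a class to which it does not belong. *)
Lemma rep_homogeneous l x z w : x < n.+2 -> 0 < z <= n -> 0 < w <= n ->
  (forall t, 0 < t < n -> width t <= l -> m t <= x <= M t -> x \in corners t) ->
  rep l z = rep l w -> rep l x <> rep l z ->
  S x z = S x w /\ S z x = S w x.
Proof.
move=> xn; elim: l z w => [|l IH] z w zn wn hx e ne.
  by rewrite /= in e; rewrite e.
have hx' t : 0 < t < n -> width t <= l -> m t <= x <= M t -> x \in corners t.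
  by move=> ht hw; apply: hx => //; lia.
have ne' y : rep l.+1 y = rep l.+1 z -> rep l x <> rep l y.
  by move=> ey exy; apply: ne; rewrite -ey; apply: rep_mono exy.
case: (rep l z =P rep l w) => [e'|nzw]; first by apply: IH => //; apply: ne'.
have [||/touchedP [t [s [ht hwt hs es]]] /touchedP [t' [s' [ht' hwt' hs' es']]]] :=
  rep_split _ _ e nzw; try lia.
have out u r y : 0 < u < n -> width u = l.+1 -> r \in corners u -> rep l y = rep l r ->
    rep l.+1 y = rep l.+1 z -> (x < m u) || (M u < x).
  move=> hu hwu hr er ey; rewrite !ltnNge -negb_and; apply/negP => inn.
  apply: ne; rewrite -ey (rep_mono (leqnSn l) er).
  apply: (@rep_corners u) => //; first by rewrite hwu.
  by apply: hx => //; rewrite hwu.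
have o := out _ _ z ht hwt hs es erefl.
have o' := out _ _ w ht' hwt' hs' es' (esym e).
have mt : m t \in corners t by rewrite !inE eqxx !orbT.
have mt' : m t' \in corners t' by rewrite !inE eqxx !orbT.
(* Equal widths give equal intervals, so this element is a corner of both constraints. Comparisons
   with x are carried along the chain z, s, [m t] = [m t'], s', w. *)
have mm : m t = m t'.
  have := @nested _ _ ht ht'; have := @nested _ _ ht' ht; rewrite hwt hwt' leqnn; lia.
have [|p1 p2] := IH z s zn _ hx' es (ne' _ erefl).
  exact: inside_range ht (corner_inside ht hs).
have [|q1 q2] := IH w s' wn _ hx' es' (ne' _ (esym e)).
  exact: inside_range ht' (corner_inside ht' hs').
have [r1 r2] := corner_outside ht hs xn o.
have [r3 r4] := corner_outside ht mt xn o.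
have [r5 r6] := corner_outside ht' hs' xn o'.
have [r7 r8] := corner_outside ht' mt' xn o'.
by rewrite p1 p2 q1 q2 r1 r2 -r3 -r4 r5 r6 -r7 -r8 mm.
Qed.

(** * Zones around the two ends of an interval *)

Definition side l c z :=
  if rep l z == rep l c then 1 else if S z c then 0 else if S c z then 2 else 1.

(* At the level of width [l + 1]: 0 before both ends, 1 the first end, 2 between the ends,
   3 the second end, 4 after both ends. *)
Definition zone l z :=
  if [seq t <- iota 1 n.-1 | width t == l.+1] is t :: _
  then side l (m t) z + side l (M t) z else 0.

(** Constraints of one width share their interval, so the first one found stands for all. Adding the
    two sides makes it irrelevant which of [m t] and [M t] comes first in S; if they are
    incomparable, both ends fall in zone 2. *)
Lemma zoneE t l z : 0 < t < n -> width t = l.+1 ->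
  zone l z = side l (m t) z + side l (M t) z.
Proof.
move=> ht hw; rewrite /zone; case E: [seq t <- _ | _] => [|u r].
  have : t \in [seq t <- iota 1 n.-1 | width t == l.+1].
    by rewrite mem_filter hw eqxx mem_iota; lia.
  by rewrite E.
have : u \in [seq t <- iota 1 n.-1 | width t == l.+1] by rewrite E mem_head.
rewrite mem_filter mem_iota => /andP[/eqP hwu hu].
have hu' : 0 < u < n by lia.
have := nested hu' ht; have := nested ht hu'; rewrite hw hwu leqnn.
by move=> [] // a1 a2 [] // a3 a4; congr (side l _ z + side l _ z); lia.
Qed.

(** A narrower interval is nested in that of t, so when it contains [m t] or [M t] it has this
    element as its own end; this is the premise of [rep_homogeneous]. *)
Lemma end_homogeneous t l c z w : 0 < t < n -> width t = l.+1 -> c \in [:: m t; M t] ->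
  0 < z <= n -> 0 < w <= n -> rep l z = rep l w -> rep l c <> rep l z ->
  S c z = S c w /\ S z c = S w c.
Proof.
move=> ht hw hc zn wn; apply: rep_homogeneous => //.
  by have [|b1 b2 b3] := @bounds t; [lia|move: hc; rewrite !inE; lia].
move=> u hu hwu; have [|a1 a2] := nested hu ht; first by rewrite hw; lia.
by move: hc; rewrite !inE; have := width_gt0 hu; rewrite /width; lia.
Qed.

Lemma side_class t l c z w : 0 < t < n -> width t = l.+1 -> c \in [:: m t; M t] ->
  0 < z <= n -> 0 < w <= n -> rep l z = rep l w -> side l c z = side l c w.
Proof.
move=> ht hw hc zn wn e; rewrite /side e; case: eqP => // ne.
by have [|-> ->] := end_homogeneous ht hw hc zn wn e => // /esym; rewrite e.
Qed.

Lemma zone_class l z w : 0 < z <= n -> 0 < w <= n -> rep l z = rep l w ->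
  zone l z = zone l w.
Proof.
move=> zn wn e; rewrite /zone; case E: [seq t <- _ | _] => [//|u r].
have : u \in [seq t <- iota 1 n.-1 | width t == l.+1] by rewrite E mem_head.
rewrite mem_filter mem_iota => /andP[/eqP hwu hu].
have hu' : 0 < u < n by lia.
by rewrite !(side_class hu' hwu _ zn wn e) // !inE eqxx ?orbT.
Qed.

(** Earlier merging would put each end in an interval of width at most l; the wider of these two
    contains both ends and so has width at least l + 1. *)
Lemma rep_ends t l : 0 < t < n -> width t = l.+1 -> rep l (m t) <> rep l (M t).
Proof.
move=> ht hw e; have [a1 a2] := inner_bounds ht.
have [|b1 b2 b3] := @bounds t; first lia.
have [|||u hu [w1 i1]] := rep_inside _ _ _ e; try lia.
have [|||v hv [w2 i2]] := rep_inside _ _ _ (esym e); try lia.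
move: hw w1 w2; rewrite /width => hw w1 w2.
by case: (leqP (width u) (width v)) => [/(nested hu hv)|/ltnW/(nested hv hu)];
  rewrite /width; lia.
Qed.

Lemma S_asym x y : x < n.+2 -> y < n.+2 -> x != y -> S x y -> S y x = false.
Proof. by move=> xn yn xy h; apply/negP => /(S_anti xn yn xy h). Qed.

(** If z is in the class of the other end d, homogeneity reduces the claim to comparing c with d.
    Otherwise z is comparable with d, and the mixed cases, z between c and d, are decided by
    transitivity through z. *)
Lemma zone_end t l c d z : 0 < t < n -> width t = l.+1 ->
    (c = m t /\ d = M t) \/ (c = M t /\ d = m t) ->
    0 < z <= n -> touched l.+1 (rep l) z -> rep l z <> rep l c ->
  (S z c -> zone l z < zone l c) /\ (S c z -> zone l c < zone l z).
Proof.
move=> ht hw hcd zn /touchedP [t' [s [ht' hw' hs es]]] nzc.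
have [a1 a2] := inner_bounds ht.
have [|b1 b2 b3] := @bounds t; first lia.
have hc : c \in [:: m t; M t] by case: hcd => -[-> _]; rewrite !inE eqxx ?orbT.
have hd : d \in [:: m t; M t] by case: hcd => -[_ ->]; rewrite !inE eqxx ?orbT.
have cn : 0 < c <= n by case: hcd => -[-> _]; lia.
have dn : 0 < d <= n by case: hcd => -[_ ->]; lia.
have ncd : rep l c <> rep l d.
  by have := rep_ends ht hw; case: hcd => -[-> ->] // + /esym.
have zE y : zone l y = side l c y + side l d y.
  by rewrite (zoneE _ ht hw); case: hcd => -[-> ->] //; rewrite addnC.
have zc : z != c by apply/eqP => e; rewrite e in nzc.
have cd : c != d by apply/eqP => e; rewrite e in ncd.
have sdc : side l d c <= 2 by rewrite /side; do !case: ifP.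
have scc : side l c c = 1 by rewrite /side eqxx.
have dcE : side l d c = if S c d then 0 else if S d c then 2 else 1.
  by rewrite /side (introF eqP ncd).
have czE : side l c z = if S z c then 0 else if S c z then 2 else 1.
  by rewrite /side (introF eqP nzc).
rewrite !zE scc dcE czE.
have [lt_z lt_c lt_d] : [/\ z < n.+2, c < n.+2 & d < n.+2] by split; lia.
case: (rep l z =P rep l d) => [ezd|nzd].
  have [h1 h2] := end_homogeneous ht hw hc zn dn ezd (not_eq_sym nzc).
  have -> : side l d z = 1 by rewrite /side ezd eqxx.
  split=> h.
    have hdc : S d c by rewrite -h2.
    by rewrite h hdc (S_asym lt_d lt_c _ hdc) // eq_sym.
  have hcd' : S c d by rewrite -h1.
  by rewrite h hcd' (S_asym lt_c lt_z _ h) // eq_sym.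
have zd : z != d by apply/eqP => e; rewrite e in nzd.
have [e1 e2] : m t' = m t /\ M t' = M t.
  have := nested ht ht'; have := nested ht' ht; rewrite hw hw' leqnn; lia.
have sn : 0 < s <= n by apply: inside_range ht' (corner_inside ht' hs).
(* The class of z contains a corner s of t' which is neither end, so s is t' or t' + 1, and d lies
   between these two in S. *)
have ctp : S z d || S d z.
  have ht'n : t' <= n by lia.
  have cmp y : y \in [:: t'; t'.+1] -> S y d || S d y.
    have [l1 l2] := closed_low S_closed ht'n.
    have [h1 h2] := closed_high S_closed ht'n.
    rewrite e1 in l1 l2; rewrite e2 in h1 h2.
    rewrite !inE; case: (ends_cases t') => -[E1 E2]; rewrite E1 E2 in l1 l2 h1 h2;
    by case: hcd => -[_ ->] /orP[] /eqP ->; rewrite ?l1 ?l2 ?h1 ?h2 ?orbT.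
  have [h1 h2] := end_homogeneous ht hw hd zn sn es (not_eq_sym nzd).
  rewrite h1 h2; apply: cmp; move: hs; rewrite !inE e1 e2.
  have nsc : s != c by apply/eqP => e; rewrite e in es.
  have nsd : s != d by apply/eqP => e; rewrite e in es.
  by move: nsc nsd; case: hcd => -[-> ->] /negbTE-> /negbTE->; rewrite !orbF.
have -> : side l d z = if S z d then 0 else 2.
  by rewrite /side (introF eqP nzd); case: (S z d) ctp => //= ->.
split=> h.
  rewrite h; case: ifP ctp => //= nzd' hdz.
  have hdc := S_trans lt_d lt_z lt_c hdz h.
  by rewrite hdc (S_asym lt_d lt_c _ hdc) // eq_sym.
have -> : S z c = false by apply: S_asym lt_c lt_z _ h; rewrite eq_sym.
rewrite h; case hzd : (S z d); last by case: ifP => //; case: ifP.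
by rewrite (S_trans lt_c lt_z lt_d h hzd).
Qed.

(* Classes in the same zone are ordered arbitrarily, by their names. *)
Definition rank l z := zone l z * (n + n).+1 + rep l z.
Definition base := 5 * (n + n).+1.

(** Positional notation in base [base], with the widest level as leading digit: comparing keys is
    the recursive ordering from the widest interval down. The base allows five zones times 2n + 1
    class names. *)
Fixpoint key l z := if l is l'.+1 then rank l' z * base ^ l' + key l' z else 0.

Lemma rank_bound l z : z <= n -> l <= n -> rank l z < base.
Proof.
move=> zn ln; have := rep_leq l zn.
have : zone l z <= 4.
  by rewrite /zone; case: [seq _ <- _ | _] => // t _; rewrite /side; do !case: ifP.
rewrite /rank /base; nia.
Qed.

Lemma key_bound l z : z <= n -> l <= n -> key l z < base ^ l.
Proof.
move=> zn; elim: l => [//|l IH] ln /=.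
have := rank_bound zn (ltnW ln); have := IH (ltnW ln); rewrite expnS.
move: (base ^ l) (rank l z) (key l z) => p r k.
move=> hk hr; apply: leq_trans (_ : r * p + p <= _).
  by rewrite ltn_add2l.
by rewrite addnC -mulSn leq_mul2r hr orbT.
Qed.

Lemma rank_class l z w : 0 < z <= n -> 0 < w <= n -> rep l z = rep l w ->
  rank l z = rank l w.
Proof. by move=> zn wn e; rewrite /rank (zone_class zn wn e) e. Qed.

Lemma rank_neq l z w : z <= n -> w <= n -> l <= n -> rep l z <> rep l w ->
  rank l z <> rank l w.
Proof.
move=> zn wn ln ne; have lw := rep_leq l wn; have lz := rep_leq l zn.
move=> /(congr1 (modn^~ (n + n).+1)); rewrite /= !modnMDl !modn_small //; lia.
Qed.

(** Elements merged at level l + 1 agree in all digits above l, and the digits below l together stay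
    under [base ^ l], so digit l decides. *)
Lemma key_ltn l L z w : 0 < z <= n -> 0 < w <= n -> l < L -> L <= n ->
  rep l.+1 z = rep l.+1 w -> rank l z < rank l w -> key L z < key L w.
Proof.
move=> zn wn + + e r; elim: L => [//|L IH]; rewrite ltnS leq_eqVlt => /orP[/eqP <- ln|lL ln] /=.
  have := key_bound (proj2 (andP zn)) (ltnW ln).
  move: (base ^ l) (key l z) (key l w) => p a b h.
  apply: (@leq_trans (rank l z * p + p)); first by rewrite ltn_add2l.
  by rewrite addnC -mulSn; apply: leq_trans (leq_addr _ _); rewrite leq_mul2r r orbT.
by rewrite (rank_class zn wn (rep_mono lL e)) ltn_add2l; apply: IH => //; apply: ltnW.
Qed.

Lemma rep_meet l z w : z <> w -> rep l z = rep l w ->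
  exists2 k, k < l & rep k.+1 z = rep k.+1 w /\ rep k z <> rep k w.
Proof.
move=> zw; elim: l => [//|l IH] e.
case: (rep l z =P rep l w) => [/IH [k kl h]|ne]; last by exists l.
by exists k => //; apply: ltnW.
Qed.

Lemma rep_top z w : 0 < z <= n -> 0 < w <= n -> rep n z = rep n w.
Proof.
suff H y : 0 < y <= n -> rep n y = rep n 1 by move=> /H -> /H ->.
elim: y => [//|y IH] yn; case: (posnP y) => [-> //|y0].
rewrite -IH; last lia.
apply: (@rep_corners y); rewrite ?inE ?eqxx ?orbT //; first lia.
by have := @width_gt0 y; lia.
Qed.

Lemma key_inj z w : 0 < z <= n -> 0 < w <= n -> key n z = key n w -> z = w.
Proof.
move=> zn wn e; apply/eqP; apply/negPn/negP => /eqP zw.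
have [k kn [e1 ne]] := rep_meet zw (rep_top zn wn).
have := rank_neq (l := k) _ _ _ ne; rewrite /not => r.
case: (ltngtP (rank k z) (rank k w)) => [lt|lt|//]; last by apply: r => //; lia.
- by have := key_ltn zn wn kn (leqnn n) e1 lt; rewrite e ltnn.
- by have := key_ltn wn zn kn (leqnn n) (esym e1) lt; rewrite e ltnn.
Qed.

(** Consider the level at which z and c first merge. There c lies in an interval of that width; by
    nesting inside the interval of t it is an end of it as well, so [zone_end] applies and decides
    the leading differing digit. *)
Lemma key_end t c z : 0 < t < n -> c \in [:: m t; M t] -> 0 < z <= n -> z <> c ->
    rep (width t) z = rep (width t) c ->
  (S z c -> key n z < key n c) /\ (S c z -> key n c < key n z).
Proof.
move=> ht hc zn zc e.
have [a1 a2] := inner_bounds ht.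
have [|b1 b2 b3] := @bounds t; first lia.
have cn : 0 < c <= n by move: hc; rewrite !inE => /orP[] /eqP ->; lia.
have [k kw [e1 ne]] := rep_meet zc e.
have [||tz /touchedP [u [s [hu hwu hs es]]]] := rep_split _ _ e1 ne; try lia.
have hcu : m u <= c <= M u.
  case: (c =P s) => [->|/eqP cs]; first exact: corner_inside hs.
  have [|v hv [wv iv]] := rep_inside cn _ cs es.
    exact: inside_range hu (corner_inside hu hs).
  by have := nested hv hu; rewrite hwu; lia.
have [|n1 n2] := nested hu ht; first by rewrite hwu.
have hcd : exists d, (c = m u /\ d = M u) \/ (c = M u /\ d = m u).
  move: hc; rewrite !inE => /orP[] /eqP ce; [exists (M u); left|exists (m u); right];
  split=> //; lia.
case: hcd => d hcd; have [z1 z2] := zone_end hu hwu hcd zn tz ne.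
have := width_gt0 ht => wn.
have kn : k < n by lia.
have rb y : 0 < y <= n -> rep k y <= n + n by move=> yn; have := @rep_leq k y; lia.
have := rb _ cn; have := rb _ zn => r1 r2.
have radix y y' : zone k y < zone k y' -> rep k y <= n + n -> rank k y < rank k y'.
  move=> lt r0; apply: (@leq_trans (zone k y * (n + n).+1 + (n + n).+1)).
    by rewrite ltn_add2l ltnS.
  by rewrite -mulSnr; apply: leq_trans (leq_addr _ _); rewrite leq_mul2r lt orbT.
split=> h; first by apply: (key_ltn zn cn kn) => //; apply: radix (z1 h) r1.
by apply: (key_ltn cn zn kn) => //; apply: radix (z2 h) r2.
Qed.

(** An x outside the class meets it only at a level k >= l, where z and w still have the same digit;
    that digit alone separates x from both. *)
Lemma key_contiguous l x z w : 0 < x <= n -> 0 < z <= n -> 0 < w <= n ->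
  rep l z = rep l w -> rep l x <> rep l z -> (key n x < key n z) = (key n x < key n w).
Proof.
move=> xn zn wn e ne.
have xz : x <> z by move=> h; rewrite h in ne.
have [k kn [e1 ne1]] := rep_meet xz (rep_top xn zn).
have lk : l <= k.
  rewrite leqNgt; apply/negP => kl; apply: ne.
  exact: rep_mono kl e1.
have e2 := rank_class zn wn (rep_mono lk e).
have e3 := rep_mono (leqW lk) e.
have rn : rank k x <> rank k z by apply: rank_neq => //; lia.
case: (ltngtP (rank k x) (rank k z)) => [lt|lt|//].
- have lt' := lt; rewrite e2 in lt'.
  by rewrite (key_ltn xn zn kn (leqnn n) e1 lt) (key_ltn xn wn kn (leqnn n) (etrans e1 e3) lt').
- have lt' := lt; rewrite e2 in lt'.
  have := key_ltn zn xn kn (leqnn n) (esym e1) lt.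
  have := key_ltn wn xn kn (leqnn n) (esym (etrans e1 e3)) lt'.
  lia.
Qed.

(** * The elements 0, 1, n, n + 1 and the outer constraints *)

Definition full_key x :=
  if x == 0 then 0 else if x == n.+1 then (base ^ n).+1 else (key n x).+1.

Lemma full_keyE x : 0 < x <= n -> full_key x = (key n x).+1.
Proof. by move=> xn; rewrite /full_key; do 2!(case: eqP => [?|_]; first lia). Qed.

Lemma full_key0 : full_key 0 = 0. Proof. by []. Qed.

Lemma full_key_last : full_key n.+1 = (base ^ n).+1.
Proof. by rewrite /full_key eqxx. Qed.

Lemma full_key_cases x : x < n.+2 -> [\/ x = 0, x = n.+1 | 0 < x <= n].
Proof.
move=> xn; case: (posnP x) => [->|x0]; first by constructor 1.
by case: (ltngtP x n.+1) => [lt|gt|->]; [constructor 3|lia|constructor 2].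
Qed.

Lemma full_key_leq x y : 0 < x <= n -> 0 < y <= n ->
  (full_key x <= full_key y) = (key n x <= key n y).
Proof. by move=> xn yn; rewrite !full_keyE. Qed.

Lemma key_lt_base x : x <= n -> (key n x) < base ^ n.
Proof. by move=> xn; apply: key_bound. Qed.

(** The interval of 1 must start at 1 and that of n - 1 must end at n; the wider one contains the
    other. This makes 1 and n ends of an interval, as needed for the constraints t = 0 and t = n. *)
Lemma widest : 1 < n -> exists t, [/\ 0 < t < n, m t = 1 & M t = n].
Proof.
move=> n1.
have h1 : 0 < 1 < n by lia.
have h2 : 0 < n.-1 < n by lia.
have [a1 a2] := inner_bounds h1; have [b1 b2] := inner_bounds h2.
have [|c1 c2 c3] := @bounds 1; first lia.
have [|d1 d2 d3] := @bounds n.-1; first lia.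
by case: (leqP (width 1) (width n.-1)) => [/(nested h1 h2)|/ltnW/(nested h2 h1)] h;
  [exists n.-1|exists 1]; split=> //; lia.
Qed.

Lemma key_extreme c z : c \in [:: 1; n] -> 0 < z <= n -> z <> c ->
  (S z c -> key n z < key n c) /\ (S c z -> key n c < key n z).
Proof.
rewrite !inE => hc zn zc; have n1 : 1 < n by lia.
have [t [ht m1 Mn]] := widest n1.
have hc' : c \in [:: m t; M t] by rewrite m1 Mn !inE.
apply: (key_end ht hc' zn zc).
have [k ek] : exists k, width t = k /\ n.-1 = k by exists n.-1; rewrite /width m1 Mn; lia.
suff H y : 0 < y <= n -> rep (width t) y = rep (width t) 1.
  by rewrite (H z zn) (H c) //; lia.
elim: y => [//|y IH] yn; case: (posnP y) => [-> //|y0].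
rewrite -IH; last lia.
apply: (@rep_corners y); rewrite ?inE ?eqxx ?orbT //; first lia.
by have := @width_gt0 y; lia.
Qed.

Theorem realizable_of_closed : realizable n F.
Proof.
apply: (@realizable_of_key n F full_key).
- move=> x y /full_key_cases hx /full_key_cases hy.
  case: hx hy => [->|->|xn] [->|->|yn] //;
    rewrite ?full_key0 ?full_key_last ?full_keyE //.
  + by have := @key_lt_base y; lia.
  + by have := @key_lt_base x; lia.
  + by move=> [] /(key_inj xn yn).
- move=> x /full_key_cases [->|->|xn]; rewrite ?full_key0 ?full_key_last ?leqnn //.
  by rewrite full_keyE //; have := @key_lt_base x; lia.
move=> t tn; have [b1 b2 b3] := bounds tn.
have one_n : 0 < 1 <= n by lia.
have n_n : 0 < n <= n by lia.
have [l1 l2] := closed_low S_closed tn; have [h1 h2] := closed_high S_closed tn.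
case: (posnP t) => [t0|t_gt0].
  subst t; have Mn := high0; have m0 : m 0 = 0 by lia.
  rewrite m0 full_key0 direction0.
  have kM : full_key (M 0) <= full_key 1.
    rewrite full_key_leq //; last lia.
    case: (M 0 =P 1) => [->//|M1]; apply: ltnW.
    have [|||+ _] := @key_extreme 1 (M 0); rewrite ?inE ?eqxx //; try lia; apply.
    by move: h2; rewrite /second_end direction0.
  split; first by split; [|lia|rewrite full_keyE].
  split; [lia|lia|move=> x xn /andP[_]].
  rewrite max0n /= => kx; rewrite leqNgt; apply/negP => Mx.
  (* Since x > M_0, the outside rule turns the frame fact that 0 precedes x into 1 preceding x, so x
     cannot lie between 0 and 1. *)
  have [_] : S x 0 = S x 1 /\ S 0 x = S 1 x.
    by apply: (closed_outside S_closed) => //; rewrite Mx orbT.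
  have [] := @closed_frame _ _ _ S_closed x.-1; first lia.
  rewrite prednK; last lia.
  move=> -> _ /esym S1x.
  case: (full_key_cases xn) => [x0|xl|x_in]; first by rewrite x0 in Mx.
    by move: kx; rewrite xl full_key_last full_keyE //; have := @key_lt_base 1; lia.
  have [|||_ /(_ S1x)] := @key_extreme 1 x; rewrite ?inE ?eqxx //; try lia.
  by move: kx; rewrite full_key_leq //; lia.
case: (ltngtP t n) => [t_lt|?|t_n]; [|lia|].
  have ht : 0 < t < n by lia.
  have [a1 a2] := inner_bounds ht.
  have m_in : 0 < m t <= n by lia.
  have M_in : 0 < M t <= n by lia.
  have t_in : 0 < t <= n by lia.
  have t1_in : 0 < t.+1 <= n by lia.
  have nk : full_key t <> full_key t.+1.
    by rewrite !full_keyE // => -[] /(key_inj t_in t1_in); lia.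
  have corner s s' : s \in corners t -> s' \in corners t ->
      rep (width t) s = rep (width t) s' by apply: rep_corners.
  have leE z c : z \in corners t -> 0 < z <= n -> c \in [:: m t; M t] ->
      (S z c -> full_key z <= full_key c) /\ (S c z -> full_key c <= full_key z).
    move=> hz zn hc; have cn : 0 < c <= n by move: hc; rewrite !inE => /orP[] /eqP ->.
    rewrite !full_key_leq //; case: (z =P c) => [->//|zc].
    have [|g1 g2] := key_end ht hc zn zc.
      by apply: corner => //; move: hc; rewrite !inE => /orP[] ->; rewrite ?orbT.
    by split=> [/g1|/g2] /ltnW.
  have tc : t \in corners t by rewrite !inE eqxx.
  have tc1 : t.+1 \in corners t by rewrite !inE eqxx orbT.
  have mE : m t \in [:: m t; M t] by rewrite !inE eqxx.
  have ME : M t \in [:: m t; M t] by rewrite !inE eqxx orbT.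
  have [p1 p2] := leE t (m t) tc t_in mE; have [p3 p4] := leE t.+1 (m t) tc1 t1_in mE.
  have [q1 q2] := leE t (M t) tc t_in ME; have [q3 q4] := leE t.+1 (M t) tc1 t1_in ME.
  have dir : (full_key t < full_key t.+1) = (F t).2 /\
      [/\ minn (full_key t) (full_key t.+1) <= full_key (m t) <=
            maxn (full_key t) (full_key t.+1) &
          minn (full_key t) (full_key t.+1) <= full_key (M t) <=
            maxn (full_key t) (full_key t.+1)].
    move: l1 l2 h1 h2; rewrite /first_end /second_end; case: ((F t).2) => l1 l2 h1 h2.
        by move: nk (p1 l1) (p4 l2) (q1 h1) (q4 h2); clear; lia.
    by move: nk (p3 l1) (p2 l2) (q3 h1) (q2 h2); clear; lia.
  have [d1 [d2 d3]] := dir.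
  clear p1 p2 p3 p4 q1 q2 q3 q4 leE dir l1 l2 h1 h2 mE ME.
  have adj := corner _ _ tc tc1; clear corner tc tc1; split; first by split=> //; lia.
  split=> // x xn btw.
  case: (full_key_cases xn) => [x0|xl|x_in].
  - by move: btw; rewrite x0 full_key0 !full_keyE //; lia.
  - move: btw; rewrite xl full_key_last !full_keyE //.
    by have := @key_lt_base t; have := @key_lt_base t.+1; lia.
  apply/negPn/negP => out.
  (* Being merged with t by this level would put x in an interval nested in [m_t, M_t]. Hence x is
     foreign to the class of t and t + 1, and contiguity keeps it from separating them. *)
  have rx : rep (width t) x <> rep (width t) t.
    move=> e; have xt : x != t by apply/eqP => xt; lia.
    have [u hu [wu iu]] := rep_inside x_in t_in xt e.
    by have := nested hu ht wu; lia.
  have := key_contiguous x_in t_in t1_in adj rx.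
  have xt : key n x <> key n t by move=> /(key_inj x_in t_in); lia.
  have xt1 : key n x <> key n t.+1 by move=> /(key_inj x_in t1_in); lia.
  by move: btw; rewrite !full_keyE //; lia.
subst t; have mn := low_last; have Mn : M n = n.+1 by lia.
rewrite Mn full_key_last direction_last.
have km : full_key n <= full_key (m n).
  rewrite full_key_leq //; last lia.
  case: (m n =P n) => [->//|mn']; apply: ltnW.
  have [|||_ +] := @key_extreme n (m n); rewrite ?inE ?eqxx ?orbT //; try lia; apply.
  by move: l1; rewrite /first_end direction_last.
have kn := @key_lt_base n (leqnn n).
have km' := @key_lt_base (m n) b1.
split; first by split; [lia|lia|rewrite full_keyE //; lia].
rewrite !full_keyE ?ltnS in km *; try lia.
split; [lia|lia|move=> x xn /andP[+ _]].
move=> kx; suff: m n <= x by lia.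
rewrite leqNgt; apply/negP => mx.
have [+ _] : S x n = S x n.+1 /\ S n x = S n.+1 x.
  by apply: (closed_outside S_closed) => //; rewrite mx.
have [|_ ->] := @closed_frame _ _ _ S_closed x; first lia.
move=> Sxn.
case: (full_key_cases xn) => [x0|xl|x_in]; last first.
- have [|||/(_ Sxn) + _] := @key_extreme n x; rewrite ?inE ?eqxx ?orbT //; try lia.
  by move: kx; rewrite full_keyE //; lia.
- lia.
- by move: kx; rewrite x0 full_key0; lia.
Qed.

End Order.

Theorem realizableP n F S : 0 < n -> valid_profile n F -> linear_profile n F ->
    closed n F S ->
    (forall C, closed n F C -> forall x y, x < n.+2 -> y < n.+2 -> S x y -> C x y) ->
  realizable n F <-> ~~ S n.+1 0.
Proof.
move=> n0 Fv Fl Sc Smin; split=> [[s [fs sF]]|nS].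
  apply/negP => /(Smin _ (closed_pos fs sF) _ _ (ltnSn _) (ltn0Sn _)).
  by rewrite (pos0 fs) (pos_last fs).
apply: (realizable_of_closed n0 Fv Fl Sc) => x y xn yn xy h1 h2.
by rewrite (closed_collapse Sc xn yn xy h1 h2) in nS.
Qed.

(** * Structured RAM programs *)

Definition exec_instr (i : instr) (m : memory) : memory :=
  match i with
  | IConst i c => upd m i c
  | IAdd i j l => upd m i (m j + m l)
  | ISub i j l => upd m i (m j - m l)
  | ILoad i j => upd m i (m (m j))
  | IStore i j => upd m (m i) (m j)
  | IJz _ _ | IHalt => m
  end.

Definition exec (l : seq instr) (m : memory) : memory := foldl (fun m i => exec_instr i m) m l.

Definition sequential (i : instr) := if i is (IJz _ _ | IHalt) then false else true.

(* Register 2 is assumed to hold 1 and register 3 to hold 0; the body of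
   [For r lim c] sees in register [r] the indices below [lim] in decreasing order. *)
Inductive cmd : Type :=
| Block of seq instr
| Then of cmd & cmd
| For of nat & nat & cmd.

Fixpoint csize c :=
  match c with
  | Block l => size l
  | Then c1 c2 => csize c1 + csize c2
  | For _ _ c => csize c + 4
  end.

Fixpoint well_formed c :=
  match c with
  | Block l => all sequential l
  | Then c1 c2 => well_formed c1 && well_formed c2
  | For _ _ c => well_formed c
  end.

(** Register 3 supplies what the instruction set lacks: adding it gives a move, and [IJz 3] is an
    unconditional jump back to the loop test at [off.+1]. Jump targets are absolute, hence the
    offset. *)
Fixpoint compile off c : program :=
  match c with
  | Block l => l
  | Then c1 c2 => compile off c1 ++ compile (off + csize c1) c2
  | For r lim c =>
      [:: IAdd r lim 3; IJz r (off + (csize c + 4)); ISub r r 2]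
      ++ compile (off + 3) c ++ [:: IJz 3 off.+1]
  end.

(** Each iteration adds the test, the decrement and the jump back to the body; the 2 counts the
    initial copy and the final test. N bounds every loop limit. *)
Fixpoint cost N c :=
  match c with
  | Block l => size l
  | Then c1 c2 => cost N c1 + cost N c2
  | For _ _ c => N * (cost N c + 3) + 2
  end.

Lemma size_compile off c : size (compile off c) = csize c.
Proof.
elim: c off => [l|c1 IH1 c2 IH2|r lim c IH] off //=; first by rewrite size_cat IH1 IH2.
by rewrite size_cat IH /=; lia.
Qed.

Lemma cost_poly c : exists a d, forall N, 0 < N -> cost N c <= a * N ^ d.
Proof.
elim: c => [l|c1 [a1 [d1 h1]] c2 [a2 [d2 h2]]|r lim c [a [d h]]].
- by exists (size l), 0 => N _ /=; rewrite muln1.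
- exists (a1 + a2), (d1 + d2) => N N0 /=; rewrite mulnDl.
  have p1 := h1 N N0; have p2 := h2 N N0.
  apply: leq_add.
    by apply: leq_trans p1 _; rewrite leq_mul2l leq_pexp2l ?orbT ?leq_addr.
  by apply: leq_trans p2 _; rewrite leq_mul2l leq_pexp2l ?orbT ?leq_addl.
exists (a + 5), d.+1 => N N0 /=; have p := h N N0.
have e0 : 0 < N ^ d by rewrite expn_gt0 N0.
rewrite expnS; move: (N ^ d) e0 p => e e0 p.
have : N * cost N c <= N * (a * e) by rewrite leq_mul2l p orbT.
have : 1 <= N * e by rewrite muln_gt0 N0.
have : N * 1 <= N * e by rewrite leq_mul2l e0 orbT.
rewrite mulnDr mulnDl (mulnCA N a e); move: (N * e) (N * cost N c) => x y; lia.
Qed.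

Definition code_at (p : program) off (l : seq instr) :=
  forall k, k < size l -> nth IHalt p (off + k) = nth IHalt l k.

Lemma code_at_cat p off l1 l2 : code_at p off (l1 ++ l2) ->
  code_at p off l1 /\ code_at p (off + size l1) l2.
Proof.
move=> h; split=> k hk.
  by rewrite h ?size_cat ?nth_cat ?hk //; lia.
rewrite -addnA h ?size_cat ?ltn_add2l // nth_cat ltnNge leq_addr /=.
by rewrite addKn.
Qed.

Definition runs N c m m' := forall p off, code_at p off (compile off c) ->
  exists2 k, k <= cost N c & iter k (step p) (State off m) = State (off + csize c) m'.

Lemma step_sequential p pc m i : nth IHalt p pc = i -> sequential i ->
  step p (State pc m) = State pc.+1 (exec_instr i m).
Proof. by rewrite /step /= => ->; case: i. Qed.

Lemma runs_block N l m : all sequential l -> runs N (Block l) m (exec l m).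
Proof.
move=> sl p off h; exists (size l) => //=.
elim: l off m sl h => [|i l IH] off m /=; first by rewrite addn0.
move=> /andP[si sl] h; rewrite -iterS iterSr.
have hi : nth IHalt p off = i by have := h 0; rewrite addn0 /= => ->.
rewrite (step_sequential _ hi) // IH //; first by rewrite addSnnS.
by move=> k hk; have := h k.+1; rewrite addnS /= => ->.
Qed.

Lemma runs_then N c1 c2 m m1 m2 : runs N c1 m m1 -> runs N c2 m1 m2 ->
  runs N (Then c1 c2) m m2.
Proof.
move=> h1 h2 p off /= /code_at_cat []; rewrite size_compile => a1 a2.
have [k1 le1 e1] := h1 p off a1; have [k2 le2 e2] := h2 p _ a2.
exists (k2 + k1); first lia.
by rewrite iterD e1 e2 addnA.
Qed.

Lemma runs_for N r lim c (I : nat -> memory -> Prop) m :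
    m lim <= N ->
    (forall i m1, I i m1 -> [/\ m1 3 = 0, m1 2 = 1 & m1 r = i]) ->
    I (m lim) (exec_instr (IAdd r lim 3) m) ->
    (forall i m1, i < m lim -> I i.+1 m1 ->
      exists2 m2, runs N c (exec_instr (ISub r r 2) m1) m2 & I i m2) ->
  exists2 m', runs N (For r lim c) m m' & I 0 m'.
Proof.
move=> limN Ireg I0 Istep.
suff [m' [Im' H]] : exists m', I 0 m' /\ forall p off, code_at p off (compile off (For r lim c)) ->
    exists2 k, k <= m lim * (cost N c + 3) + 1 &
    iter k (step p) (State off.+1 (exec_instr (IAdd r lim 3) m))
      = State (off + csize (For r lim c)) m'.
  exists m' => // p off h; have [k kle e] := H p off h.
  exists (k + 1).
    rewrite /=; have : m lim * (cost N c + 3) <= N * (cost N c + 3) by rewrite leq_mul2r limN orbT.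
    lia.
  rewrite iterD /= -[RHS]e; congr (iter _ _ _).
  by apply: step_sequential => //; have := h 0; rewrite addn0 => ->.
move: (m lim) (exec_instr (IAdd r lim 3) m) I0 Istep => i; elim: i => [|i IH] m1 Im1 Istep.
  exists m1; split=> // p off h; exists 1 => //=.
  have := h 1; rewrite addn1 /= => /(_ isT) hi.
  by rewrite /step /= hi; have [_ _ ->] := Ireg _ _ Im1.
have [m2 run2 I2] := Istep i m1 (leqnn _) Im1.
have [|m' [Im' H]] := IH m2 I2; first by move=> j m3 ji; apply: Istep; apply: ltnW.
exists m'; split=> // p off h.
have [k2 k2le e2] := H p off h.
have [_ h3] := code_at_cat (l1 := [:: _; _; _]) h.
have [h4 h5] := code_at_cat h3; rewrite size_compile in h5.
have [k1 k1le e1] := run2 p _ h4.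
exists (k2 + 1 + k1 + 2); first by rewrite mulSn; move: (i * _) k2le => x; lia.
rewrite iterD.
have -> : iter 2 (step p) (State off.+1 m1) = State (off + 3) (exec_instr (ISub r r 2) m1).
  rewrite /=.
  have := h 1; rewrite addn1 /= => /(_ isT) hi.
  have -> : step p (State off.+1 m1) = State off.+2 m1.
    by rewrite /step /= hi; have [_ _ ->] := Ireg _ _ Im1.
  rewrite (@step_sequential _ _ _ (ISub r r 2)) //; last by have := h 2; rewrite addn2 /= => ->.
  by rewrite addn3.
rewrite iterD e1 iterD -[RHS]e2; congr (iter _ _ _).
have := h5 0; rewrite addn0 /= => /(_ isT) hi.
by rewrite /step /= hi; have [-> _ _] := Ireg _ _ I2.
Qed.

Lemma halted_iter p j st : halted p st -> iter j (step p) st = st.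
Proof.
move=> h; elim: j => [//|j IH] /=; rewrite IH.
by move: h; rewrite /halted /step; case: (nth _ _ _).
Qed.

Lemma run_iter p fuel k st : k <= fuel -> halted p (iter k (step p) st) ->
  run p fuel st = Some (iter k (step p) st).
Proof.
elim: fuel k st => [|f IH] k st.
  by rewrite leqn0 => /eqP -> /= ->.
move=> kf /=; case: ifP => [h _|nh]; first by rewrite halted_iter.
case: k kf => [|k] kf; first by rewrite /= nh.
by rewrite iterSr => hk; apply: IH.
Qed.

(** No [IHalt] is emitted: past the end of the program, the default of [nth] is [IHalt]. *)
Lemma run_cmd N c m m' fuel : runs N c m m' -> cost N c <= fuel ->
  exists2 st, run (compile 0 c) fuel (State 0 m) = Some st & Defs.mem st = m'.
Proof.
move=> h cf; have [|k kle e] := h (compile 0 c) 0; first by move=> k _; rewrite add0n.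
exists (State (csize c) m') => //.
rewrite (run_iter (k := k)) ?e //; first exact: leq_trans kle cf.
by rewrite /halted /= nth_default // size_compile.
Qed.

(** * Saturation on the RAM *)

(** The machine cannot multiply, so the address of a row is looked up in the table at register 4. *)
Definition locate d x y := [:: IAdd d 4 x; ILoad d d; IAdd d d y].
(** Truncated subtraction from 1 negates: the result is 0 exactly for a marked cell. Negated flags
    can then be summed to form a conjunction. *)
Definition test d x y := locate d x y ++ [:: ILoad d d; ISub d 2 d].

(* Register 20 receives 1 if register [c] is nonzero and both pairs are marked, else 0. *)
Definition conj x y x' y' c := test 20 x y ++ test 21 x' y' ++
  [:: ISub 22 2 c; IAdd 20 20 21; IAdd 20 20 22; ISub 20 2 20].

(** The rule is applied without branching, by adding the 0/1 value of its premises to the target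
    cell. Cells may thus exceed 1; only being nonzero matters. *)
Definition infer x y x' y' c z w := conj x y x' y' c ++ locate 21 z w ++
  [:: ILoad 22 21; IAdd 22 22 20; IStore 21 22].

Definition mark z w := locate 21 z w ++ [:: IStore 21 2].

(** * Memory layout and specifications of commands *)

Section Layout.

Variables (n : nat) (F : profile).

(* Registers live below 32, the profile from [fb], the table of row addresses
   from [tb], and the rows of the relation from [rb]. *)
Definition fb := 8 * n + 63.
Definition tb := fb + (3 * n + 3).
Definition rb := tb + n.+2.
(** Rows are stored in reverse order because the loop filling the table counts x down while the row
    address grows. *)
Definition row x := rb + (n.+1 - x) * n.+2.
Definition addr x y := row x + y.
Definition rel_of (m : memory) : rel nat := fun x y => m (addr x y) != 0.

(** Registers 0 and 3 serve both as numbers and as the names of the elements n + 1 and 0; registers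
    0 and 5 are the loop limits for constraints and for elements. *)
Record frame (m : memory) : Prop := Frame {
  frame0 : m 0 = n.+1;
  frame1 : m 1 = fb;
  frame2 : m 2 = 1;
  frame3 : m 3 = 0;
  frame4 : m 4 = tb;
  frame5 : m 5 = n.+2;
  frame_table : forall x, x < n.+2 -> m (tb + x) = row x;
  frame_low : forall t, t <= n -> m (fb + 3 * t) = low F t;
  frame_high : forall t, t <= n -> m (fb + 3 * t + 1) = high F t;
  frame_dir : forall t, t <= n -> m (fb + 3 * t + 2) = (F t).2 }.

(** Registers k to 31 are scratch and the relation may change. A loop with counter r has a body
    keeping everything below r + 1, which protects the counters of nested loops. *)
Definition keep k (m m' : memory) := forall a, a < rb -> (a < k) || (32 <= a) -> m' a = m a.

Lemma keep_trans k m1 m2 m3 : keep k m1 m2 -> keep k m2 m3 -> keep k m1 m3.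
Proof. by move=> h1 h2 a ab ak; rewrite h2 ?h1. Qed.

Lemma keep_leq k k' m m' : k <= k' -> keep k' m m' -> keep k m m'.
Proof. by move=> kk h a ab ak; apply: h => //; lia. Qed.

Lemma frame_keep m m' : keep 6 m m' -> frame m -> frame m'.
Proof.
move=> k [f0 f1 f2 f3 f4 f5 ft fl fh fd].
split; try by [rewrite k // /rb /tb /fb; lia].
- by move=> x xn; rewrite k ?ft // /rb /tb /fb; lia.
- by move=> t tn; rewrite k ?fl // /rb /tb /fb; lia.
- by move=> t tn; rewrite k ?fh // /rb /tb /fb; lia.
- by move=> t tn; rewrite k ?fd // /rb /tb /fb; lia.
Qed.

Lemma addr_geq x y : rb <= addr x y.
Proof. by rewrite /addr /row -addnA leq_addr. Qed.

Lemma rb_geq : 32 < rb. Proof. rewrite /rb /tb /fb; lia. Qed.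

Lemma addr_inj x y x' y' : x < n.+2 -> y < n.+2 -> x' < n.+2 -> y' < n.+2 ->
  (addr x y == addr x' y') = (x == x') && (y == y').
Proof.
move=> xn yn xn' yn'; apply/eqP/andP => [|[/eqP-> /eqP->] //].
rewrite /addr /row; move: rb => r; rewrite -!addnA => /addnI e.
have ey : y = y'.
  by move: (congr1 (modn^~ n.+2) e); rewrite /= !modnMDl !modn_small.
move: e; rewrite ey => /addIn /eqP; rewrite eqn_pmul2r // => /eqP e.
by split; apply/eqP => //; lia.
Qed.

Lemma exec_cat l1 l2 m : exec (l1 ++ l2) m = exec l2 (exec l1 m).
Proof. exact: foldl_cat. Qed.

Definition writes_register k i :=
  if i is (IConst r _ | IAdd r _ _ | ISub r _ _ | ILoad r _) then k <= r < 32 else false.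

Lemma exec_writes_register k l m a : all (writes_register k) l -> (a < k) || (32 <= a) ->
  exec l m a = m a.
Proof.
move=> + ha; elim: l m => [//|i l IH] m /= /andP[wi wl].
rewrite [LHS](IH (exec_instr i m) wl).
by case: i wi => [r c|r j1 j2|r j1 j2|r j|j1 j2|j1 j2|] //= hr;
  rewrite /upd; case: eqP => // h; lia.
Qed.

Lemma exec_locate d x y m a : frame m -> 20 <= d < 32 -> x < 20 -> y < 20 -> m x < n.+2 ->
  exec (locate d x y) m a = if a == d then addr (m x) (m y) else m a.
Proof.
move=> fm /andP[d20 d32] x20 y20 mx; rewrite /= /upd; case: (a =P d) => // _.
rewrite !eqxx; have -> : (y == d) = false by lia.
rewrite (frame4 fm); have -> : (tb + m x == d) = false by rewrite /tb /fb; lia.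
by rewrite (frame_table fm).
Qed.

Lemma exec_test d x y m a : frame m -> 20 <= d < 32 -> x < 20 -> y < 20 -> m x < n.+2 ->
  exec (test d x y) m a = if a == d then ~~ rel_of m (m x) (m y) : nat else m a.
Proof.
move=> fm hd x20 y20 mx; have /andP[d20 d32] := hd.
have E b := exec_locate b fm hd x20 y20 mx.
rewrite /test exec_cat; move: (exec (locate d x y) m) E => m1 E.
rewrite /= /upd; case: (a =P d) => [_|/eqP/negbTE nd]; last first.
  by rewrite E nd.
have d2 : (2 == d) = false by lia.
have m1d : m1 d = addr (m x) (m y) by rewrite E eqxx.
rewrite eqxx m1d d2 !E d2 (frame2 fm).
have -> : (addr (m x) (m y) == d) = false.
  by have := addr_geq (m x) (m y); have := rb_geq; lia.
by rewrite /rel_of; case: (m _) => // k; rewrite subSS sub0n.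
Qed.

Lemma exec_combine c m : c < 20 ->
  let m' := exec [:: ISub 22 2 c; IAdd 20 20 21; IAdd 20 20 22; ISub 20 2 20] m in
  m' 20 = m 2 - (m 20 + m 21 + (m 2 - m c)) /\
  (forall a, (a < 20) || (23 <= a) -> m' a = m a).
Proof.
move=> c20 m'; split; first by rewrite /m' /= /upd /=.
by move=> a ha; rewrite /m' /= /upd; do !(case: eqP => [?|_]; first lia).
Qed.

Lemma exec_conj x y x' y' c m : frame m -> x < 20 -> y < 20 -> x' < 20 -> y' < 20 -> c < 20 ->
    m x < n.+2 -> m x' < n.+2 ->
  exec (conj x y x' y' c) m 20
    = [&& m c != 0, rel_of m (m x) (m y) & rel_of m (m x') (m y')]
  /\ (forall a, (a < 20) || (23 <= a) -> exec (conj x y x' y' c) m a = m a).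
Proof.
move=> fm x20 y20 x20' y20' c20 mx mx'; rewrite /conj (exec_cat (test _ _ _)) (exec_cat (test _ _ _)).
set m1 := exec (test 20 x y) m; set m2 := exec (test 21 x' y') m1.
have E1 a : m1 a = if a == 20 then ~~ rel_of m (m x) (m y) : nat else m a.
  exact: exec_test.
have low1 a : a < 20 -> m1 a = m a by move=> a20; rewrite E1; case: eqP => //; lia.
have f1 : frame m1.
  by apply: frame_keep fm => a _ ak; rewrite E1; case: eqP => //; lia.
have E2 a : m2 a = if a == 21 then ~~ rel_of m (m x') (m y') : nat else m1 a.
  have := exec_test (d := 21) a f1 isT x20' y20'; rewrite (low1 x') // (low1 y') // -/m2 => -> //.
  rewrite /rel_of E1; have -> // : (addr (m x') (m y') == 20) = false.
  by have := addr_geq (m x') (m y'); have := rb_geq; lia.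
have [g1 g2] := exec_combine m2 c20; split=> [|a ha]; last first.
  by rewrite g2 // E2 E1; do !(case: eqP => [?|_]; first lia).
rewrite g1 !E2 !E1 /= (ltn_eqF c20) (frame2 fm).
have -> : (c == 21) = false by lia.
by case: (rel_of m _ _); case: (rel_of m _ _); case: (m c).
Qed.

(** Besides growth, new marks must stay inside every closed relation containing the old ones;
    composed over the whole run, this gives leastness. *)
Definition extends (m m' : memory) :=
  (forall x y, x < n.+2 -> y < n.+2 -> rel_of m x y -> rel_of m' x y) /\
  (forall C, closed n F C ->
    (forall x y, x < n.+2 -> y < n.+2 -> rel_of m x y -> C x y) ->
    forall x y, x < n.+2 -> y < n.+2 -> rel_of m' x y -> C x y).

Lemma extends_refl m : extends m m. Proof. by []. Qed.

Lemma extends_trans m1 m2 m3 : extends m1 m2 -> extends m2 m3 -> extends m1 m3.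
Proof.
move=> [a1 b1] [a2 b2]; split; first by move=> x y xn yn /(a1 _ _ xn yn) /(a2 _ _ xn yn).
by move=> C cC h; apply: b2 => //; apply: b1.
Qed.

Lemma extends_eq m m' : (forall a, rb <= a -> m' a = m a) -> extends m m'.
Proof.
move=> h; have e x y : rel_of m' x y = rel_of m x y by rewrite /rel_of h // addr_geq.
by split=> [x y|C _ hC x y]; rewrite e //; apply: hC.
Qed.

(** Postconditions turn marks present at the start into marks present at the end, so they survive an
    earlier start with fewer marks and a later end with more. Facts about single steps can therefore
    be collected over a whole round. *)
Definition stable (Q : memory -> memory -> Prop) :=
  forall m0 m m' m1, extends m0 m -> Q m m' -> extends m' m1 -> Q m0 m1.

(** The bound 3(n + 1) covers every loop limit that occurs: n + 1, n + 2, and 3n when the input is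
    copied. *)
Definition spec k c (Q : memory -> memory -> Prop) m :=
  exists m', [/\ runs (3 * n.+1) c m m', keep k m m', extends m m' & Q m m'].

Lemma spec_weaken k k' c (Q Q' : memory -> memory -> Prop) m :
  k' <= k -> (forall m', Q m m' -> Q' m m') -> spec k c Q m -> spec k' c Q' m.
Proof.
move=> kk h [m' [r kp e q]]; exists m'; split=> //; last exact: h.
exact: keep_leq kp.
Qed.

Lemma spec_then k c1 c2 Q1 Q2 m : stable Q1 -> stable Q2 -> 6 <= k -> frame m ->
    spec k c1 Q1 m ->
    (forall m1, frame m1 -> keep k m m1 -> spec k c2 Q2 m1) ->
  spec k (Then c1 c2) (fun m m' => Q1 m m' /\ Q2 m m') m.
Proof.
move=> s1 s2 k6 fm [m1 [r1 k1 e1 q1]] h.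
have [|m2 [r2 k2 e2 q2]] := h m1 _ k1; first exact: frame_keep (keep_leq k6 k1) fm.
exists m2; split.
- exact: runs_then r1 r2.
- exact: keep_trans k1 k2.
- exact: extends_trans e1 e2.
- split; first exact: s1 (extends_refl _) q1 e2.
  exact: s2 e1 q2 (extends_refl _).
Qed.

Lemma spec_setup k l c Q m : stable Q -> all sequential l -> k <= 32 ->
    (forall a, (a < k) || (32 <= a) -> exec l m a = m a) ->
    spec k c Q (exec l m) ->
  spec k (Then (Block l) c) Q m.
Proof.
move=> sQ sl k32 same [m' [run' k' e' q']].
have e : extends m (exec l m).
  by apply: extends_eq => a ab; apply: same; have := rb_geq; lia.
exists m'; split.
- exact: runs_then (runs_block _ _ sl) run'.
- by move=> a ab ak; rewrite k' ?same.
- exact: extends_trans e e'.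
- exact: sQ e q' (extends_refl _).
Qed.

Lemma spec_iter r lim c (J : nat -> memory -> Prop) m :
    (forall i m1 m2, extends m1 m2 -> J i m1 -> J i m2) ->
    6 <= r < 32 -> lim < 6 -> m lim <= 3 * n.+1 -> frame m -> J (m lim) m ->
    (forall i m1, i < m lim -> frame m1 -> m1 r = i -> keep r m m1 -> J i.+1 m1 ->
      spec r.+1 c (fun _ => J i) m1) ->
  spec r (For r lim c) (fun _ => J 0) m.
Proof.
move=> sJ /andP[r6 r32] lim6 limN fm J0 h.
have r_rb : r < rb by have := rb_geq; lia.
have fk m1 : keep r m m1 -> frame m1 by move=> /(keep_leq r6) k; apply: frame_keep fm.
have upd_keep m1 v : keep r m1 (upd m1 r v).
  by move=> a ab ar; rewrite /upd; case: eqP => //; lia.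
have upd_ext m1 v : extends m1 (upd m1 r v).
  by apply: extends_eq => a ab; rewrite /upd; case: eqP => //; lia.
pose I i m1 := [/\ keep r m m1, m1 r = i, extends m m1 & J i m1].
have [|||m' run' [k' _ e' q']] := @runs_for (3 * n.+1) r lim c I m limN.
- move=> i m1 [k e _ _]; have f1 := fk _ k.
  by split=> //; [apply: frame3 f1|apply: frame2 f1].
- split=> /=; [exact: upd_keep| |exact: upd_ext|exact: sJ J0].
  by rewrite /upd eqxx (frame3 fm) addn0.
- move=> i m1 ilt [k1 m1r e1 q1] /=; set m2 := upd _ _ _.
  have k2 : keep r m m2 by apply: keep_trans k1 _; apply: upd_keep.
  have m2r : m2 r = i by rewrite /m2 /upd eqxx m1r (frame2 (fk _ k1)) subn1.
  have e12 : extends m1 m2 := upd_ext m1 _.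
  have [m3 [run3 k3 e3 q3]] := h i m2 ilt (fk _ k2) m2r k2 (sJ _ _ _ e12 q1).
  exists m3 => //; split=> //.
  - exact: keep_trans k2 (keep_leq (leqnSn r) k3).
  - by rewrite k3 // ltnSn.
  - exact: extends_trans (extends_trans e1 e12) e3.
by exists m'.
Qed.

Lemma spec_for N r lim c (Q : nat -> memory -> memory -> Prop) m :
    m lim = N -> N <= 3 * n.+1 -> (forall i, i < N -> stable (Q i)) ->
    6 <= r < 32 -> lim < 6 -> frame m ->
    (forall i m1, i < N -> frame m1 -> m1 r = i -> keep r m m1 -> spec r.+1 c (Q i) m1) ->
  spec r (For r lim c) (fun m m' => forall i, i < N -> Q i m m') m.
Proof.
move=> limN leN sQ hr lim6 fm h.
(* Indices arrive in decreasing order, so the results for all j >= i are already available at this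
   point. *)
pose J i m1 := extends m m1 /\ forall j, i <= j < N -> Q j m m1.
have [||||i m1 il f1 e1 k1 [x1 q1]|m' [run' k' e' [_ q']]] := @spec_iter r lim c J m _ hr lim6.
- move=> i m1 m2 e12 [e1 q1]; split; first exact: extends_trans e1 e12.
  by move=> j hj; apply: sQ (extends_refl _) (q1 j hj) e12; case/andP: hj.
- by rewrite limN.
- by [].
- by rewrite limN; split=> // j; lia.
- rewrite limN in il; have [m2 [run2 k2 e2 q2]] := h i m1 il f1 e1 k1.
  exists m2; split=> //; split; first exact: extends_trans x1 e2.
  move=> j /andP[ij jl]; case: (ltngtP i j) ij => // [ij|ij] _.
    by apply: sQ (extends_refl _) (q1 j _) e2; rewrite ?ij.
  by rewrite -ij; apply: sQ x1 q2 (extends_refl _).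
by exists m'; split.
Qed.

Lemma mark_cell m m' z w q : z < n.+2 -> w < n.+2 ->
    (forall a, rb <= a -> m' a = if a == addr z w then m a + q else m a) ->
  forall x y, x < n.+2 -> y < n.+2 ->
    rel_of m' x y = rel_of m x y || [&& x == z, y == w & q != 0].
Proof.
move=> zn wn h x y xn yn; rewrite /rel_of h ?addr_geq // addr_inj //.
case: (x =P z) => [->|_] /=; last by rewrite orbF.
by case: (y =P w) => [->|_] /=; rewrite ?orbF // addn_eq0 negb_and.
Qed.

Lemma exec_store_sum (m : memory) u q : 32 <= u -> m 21 = u -> m 20 = q ->
  forall a, exec [:: ILoad 22 21; IAdd 22 22 20; IStore 21 22] m a =
    if a == u then m u + q else if a == 22 then m u + q else m a.
Proof.
move=> u32 m21 m20 a; rewrite /= /upd /= m21 m20.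
by do !case: ifP.
Qed.

Lemma exec_infer x y x' y' c z w m :
    frame m -> [&& x < 20, y < 20, x' < 20, y' < 20, c < 20, z < 20 & w < 20] ->
    m x < n.+2 -> m x' < n.+2 -> m z < n.+2 ->
  let m' := exec (infer x y x' y' c z w) m in
  (forall a, rb <= a -> m' a = if a == addr (m z) (m w)
     then m a + [&& m c != 0, rel_of m (m x) (m y) & rel_of m (m x') (m y')] else m a) /\
  (forall a, a < rb -> (a < 20) || (23 <= a) -> m' a = m a).
Proof.
move=> fm /and5P[x20 y20 x20' y20' /and3P[c20 z20 w20]] mx mx' mz.
rewrite /infer (exec_cat (conj _ _ _ _ _)) (exec_cat (locate _ _ _)).
have := exec_conj fm x20 y20 x20' y20' c20 mx mx'.
move: (exec (conj x y x' y' c) m) => m1 []; set q : nat := [&& _, _ & _].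
move: q => q v1 e1.
have f1 : frame m1 by apply: frame_keep fm => a _ ak; apply: e1; lia.
have ez : m1 z = m z by rewrite e1 ?z20.
have ew : m1 w = m w by rewrite e1 ?w20.
have mz1 : m1 z < n.+2 by rewrite ez.
have E2 a := exec_locate (d := 21) a f1 isT z20 w20 mz1.
rewrite ez ew in E2.
move: (exec (locate 21 z w) m1) E2 => m2 E2.
have r1 := addr_geq (m z) (m w); have r2 := rb_geq.
move: (addr (m z) (m w)) E2 r1 => u E2 r1.
have u32 : 32 <= u by lia.
have m21 : m2 21 = u by rewrite E2.
have m20 : m2 20 = q by rewrite E2.
have u21 : (u == 21) = false by lia.
have ub : m2 u = m u by rewrite E2 u21 e1 //; lia.
have := exec_store_sum u32 m21 m20; move: (exec _ m2) => m3 E3 /=.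
split=> a ab; [|move=> ak]; rewrite E3 ub E2.
  case: (a =P u) => [->//|_]; rewrite e1; last lia.
  by do !(case: eqP => [?|_]; first lia).
by do !(case: eqP => [?|_]; first lia); rewrite e1.
Qed.

Lemma spec_infer x y x' y' c z w m :
    frame m -> [&& x < 20, y < 20, x' < 20, y' < 20, c < 20, z < 20 & w < 20] ->
    [&& m x < n.+2, m y < n.+2, m x' < n.+2, m y' < n.+2, m z < n.+2 & m w < n.+2] ->
    (forall C, closed n F C -> m c != 0 -> C (m x) (m y) -> C (m x') (m y') -> C (m z) (m w)) ->
  spec 20 (Block (infer x y x' y' c z w))
    (fun m0 m1 => m c != 0 -> rel_of m0 (m x) (m y) -> rel_of m0 (m x') (m y') ->
      rel_of m1 (m z) (m w)) m.
Proof.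
move=> fm h20 /and5P[mx my mx' my' /andP[mz mw]] imp.
have [cell low] := exec_infer fm h20 mx mx' mz.
have run := @runs_block (3 * n.+1) (infer x y x' y' c z w) m isT.
move: (exec _ m) cell low run => m' cell low run.
have R := mark_cell mz mw cell.
exists m'; split=> //.
- by move=> a ab ak; apply: low => //; lia.
- split=> [u v un vn|C cC hC u v un vn]; rewrite R //; first by move=> ->.
  case/orP; first exact: hC.
  case/and3P => /eqP -> /eqP ->; rewrite eqb0 negbK => /and3P[h1 h2 h3].
  by apply: imp => //; apply: hC.
- by move=> h1 h2 h3; rewrite R // !eqxx h1 h2 h3 orbT.
Qed.

Lemma spec_mark z w m : frame m -> z < 20 -> w < 20 -> m z < n.+2 -> m w < n.+2 ->
    (forall C, closed n F C -> C (m z) (m w)) ->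
  spec 20 (Block (mark z w)) (fun m0 m1 => rel_of m1 (m z) (m w)) m.
Proof.
move=> fm z20 w20 mz mw imp.
have run := @runs_block (3 * n.+1) (mark z w) m isT.
have r1 := addr_geq (m z) (m w); have r2 := rb_geq.
have E a : exec (mark z w) m a = if a == addr (m z) (m w) then 1
    else if a == 21 then addr (m z) (m w) else m a.
  rewrite /mark exec_cat; have := fun b => exec_locate b fm (d := 21) isT z20 w20 mz.
  move: (exec (locate 21 z w) m) => m1 E.
  by rewrite /= /upd !E /= (frame2 fm).
move: (exec (mark z w) m) E run => m' E run.
exists m'; split=> //.
- by move=> a ab ak; rewrite E; do !(case: eqP => [?|_]; first lia).
- split=> [u v un vn|C cC hC u v un vn]; rewrite /rel_of E ?addr_inj //.
    by case: ifP => // _; case: (addr u v =P 21) => [h|//]; have := addr_geq u v; lia.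
  case: ifP => [/andP[/eqP-> /eqP->] _|_]; first exact: imp.
  by case: (addr u v =P 21) => [h|_]; [have := addr_geq u v; lia|apply: hC].
- by rewrite /rel_of E eqxx.
Qed.

End Layout.

(** * The closure rules as commands *)

Definition load_constraint :=
  [:: IAdd 13 10 10; IAdd 13 13 10; IAdd 13 13 1; ILoad 11 13;
      IAdd 13 13 2; ILoad 12 13; IAdd 13 13 2; ILoad 13 13;
      IAdd 15 10 13; IAdd 14 10 2; ISub 14 14 13; IAdd 13 10 2].

(* Registers: 10 = t, 11 = m_t, 12 = M_t, 13 = t + 1, 14 and 15 = the leftmost and
   rightmost of t and t + 1, 16 = x, and 17 is nonzero iff x lies outside [m_t, M_t]. *)
Definition outside_step :=
  Then (Block [:: ISub 17 11 16; ISub 18 16 12; IAdd 17 17 18])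
  (Then (Block (infer 16 10 16 10 17 16 13))
  (Then (Block (infer 16 13 16 13 17 16 10))
  (Then (Block (infer 10 16 10 16 17 13 16))
        (Block (infer 13 16 13 16 17 10 16))))).

Definition constraint_step :=
  Then (Block load_constraint)
  (Then (Block (mark 3 13))
  (Then (Block (mark 10 0))
  (Then (Block (mark 14 11))
  (Then (Block (mark 11 15))
  (Then (Block (mark 14 12))
  (Then (Block (mark 12 15))
        (For 16 5 outside_step))))))).

(** Register 13 receives the distance of x and y, nonzero iff they differ, and guards the collapse
    rule; register 2, always 1, serves as the trivial guard for transitivity. *)
Definition pair_step :=
  Then (Block [:: ISub 13 10 11; ISub 14 11 10; IAdd 13 13 14])
  (Then (Block (infer 10 11 11 10 13 0 3))
        (For 12 5 (Block (infer 10 11 11 12 2 10 12)))).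

Definition saturation_round :=
  Then (For 10 0 constraint_step) (For 10 5 (For 11 5 pair_step)).

(** Two nested loops give (n + 2)^2 rounds, one per cell of the relation, without computing a
    product. *)
Definition saturate := For 8 5 (For 9 5 saturation_round).

Section Saturation.

Variables (n : nat) (F : profile).
Hypothesis F_valid : valid_profile n F.

Local Notation rel_of := (rel_of n).
Local Notation spec := (spec n F).
Local Notation stable := (stable n F).
Local Notation frame := (frame n F).
Local Notation extends := (extends n F).

Lemma stable_and (P Q : memory -> memory -> Prop) :
  stable P -> stable Q -> stable (fun m m' => P m m' /\ Q m m').
Proof. by move=> sP sQ m0 m m' m1 e0 [p q] e1; split; [apply: sP p e1|apply: sQ q e1]. Qed.

Lemma stable_all (I : Type) (P : I -> Prop) (Q : I -> memory -> memory -> Prop) :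
  (forall i, P i -> stable (Q i)) -> stable (fun m m' => forall i, P i -> Q i m m').
Proof. by move=> sQ m0 m m' m1 e0 q e1 i Pi; apply: sQ e0 (q i Pi) e1. Qed.

Lemma stable_fact x y : x < n.+2 -> y < n.+2 -> stable (fun _ m' => rel_of m' x y).
Proof. by move=> xn yn m0 m m' m1 _ q [e1 _]; apply: e1. Qed.

Definition implied (b : bool) x y x' y' z w (m m' : memory) :=
  b -> rel_of m x y -> rel_of m x' y' -> rel_of m' z w.

Lemma stable_implied b x y x' y' z w : x < n.+2 -> y < n.+2 -> x' < n.+2 -> y' < n.+2 ->
  z < n.+2 -> w < n.+2 -> stable (implied b x y x' y' z w).
Proof.
move=> xn yn xn' yn' zn wn m0 m m' m1 [e0 _] q [e1 _] hb h1 h2.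
by apply: e1 => //; apply: q => //; apply: e0.
Qed.

Definition outside t x := (x < low F t) || (high F t < x).

Definition outside_closed t x m m' :=
  implied (outside t x) x t x t x t.+1 m m' /\
  (implied (outside t x) x t.+1 x t.+1 x t m m' /\
  (implied (outside t x) t x t x t.+1 x m m' /\
   implied (outside t x) t.+1 x t.+1 x t x m m')).

Lemma stable_outside_closed t x : t <= n -> x < n.+2 -> stable (outside_closed t x).
Proof.
move=> tn xn; have tn2 : t < n.+2 by lia.
have tn3 : t.+1 < n.+2 by lia.
by do 3!(apply: stable_and; first exact: stable_implied); apply: stable_implied.
Qed.

(** The truncated differences m_t - x and x - M_t have a nonzero sum exactly when x is outside the
    interval. Rules with one premise repeat it to fit [infer]; each of the two equalities needs two
    implications. *)
Lemma spec_outside t x m : frame m -> t <= n -> x < n.+2 ->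
    m 10 = t -> m 11 = low F t -> m 12 = high F t -> m 13 = t.+1 -> m 16 = x ->
  spec 17 outside_step (outside_closed t x) m.
Proof.
move=> fm tn xn m10 m11 m12 m13 m16; rewrite /outside_step.
have tn2 : t < n.+2 by lia.
have tn3 : t.+1 < n.+2 by lia.
apply: spec_setup => //; first exact: stable_outside_closed.
  by move=> a ha; rewrite /= /upd; do !(case: eqP => [?|_]; first lia).
set m1 := exec _ m.
have E a : (a < 17) || (32 <= a) -> m1 a = m a.
  by move=> ha; rewrite /m1 /= /upd; do !(case: eqP => [?|_]; first lia).
have f1 : frame m1 by apply: frame_keep fm => a _ ak; apply: E; lia.
have r17 : (m1 17 != 0) = outside t x.
  by rewrite /m1 /= /upd /= m11 m16 m12 /outside; lia.
have [r10 [r13 r16]] : m1 10 = t /\ m1 13 = t.+1 /\ m1 16 = x by rewrite !E.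
clearbody m1; clear E fm m10 m11 m12 m13 m16.
have reg k m2 : keep n 18 m1 m2 -> k < 18 -> m2 k = m1 k.
  by move=> kp k18; apply: kp; [have := rb_geq n; lia|lia].
have inf m2 a b c d : frame m2 -> keep n 18 m1 m2 -> a \in [:: 10; 13; 16] ->
    b \in [:: 10; 13; 16] -> c \in [:: 10; 13; 16] -> d \in [:: 10; 13; 16] ->
    (forall C, closed n F C -> outside t x -> C (m1 a) (m1 b) -> C (m1 c) (m1 d)) ->
    spec 18 (Block (infer a b a b 17 c d))
      (implied (outside t x) (m1 a) (m1 b) (m1 a) (m1 b) (m1 c) (m1 d)) m2.
  move=> f2 k2 ha hb hc hd imp.
  have lt20 k : k \in [:: 10; 13; 16] -> k < 18 /\ m1 k < n.+2.
    by rewrite !inE => /or3P[] /eqP ->; rewrite ?r10 ?r13 ?r16.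
  have [[a1 a2] [b1 b2]] := (lt20 a ha, lt20 b hb).
  have [[c1 c2] [d1 d2]] := (lt20 c hc, lt20 d hd).
  have ea := reg a m2 k2 a1; have eb := reg b m2 k2 b1; have ec := reg c m2 k2 c1.
  have ed := reg d m2 k2 d1; have e17 := reg 17 m2 k2 isT.
  have h1 : [&& a < 20, b < 20, a < 20, b < 20, 17 < 20, c < 20 & d < 20].
    by clear -a1 b1 c1 d1; lia.
  have h2 : [&& m2 a < n.+2, m2 b < n.+2, m2 a < n.+2, m2 b < n.+2, m2 c < n.+2 & m2 d < n.+2].
    by rewrite ea eb ec ed a2 b2 c2 d2.
  have := spec_infer f2 h1 h2; rewrite ea eb ec ed e17 r17 => /(_ _)/spec_weaken; apply=> //.
  by move=> C cC h3 h4 _; apply: imp.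
have cl C : closed n F C -> outside t x -> C x t = C x t.+1 /\ C t x = C t.+1 x.
  by move=> cC; apply: (closed_outside cC).
have i1 m2 f2 k2 := inf m2 16 10 16 13 f2 k2 isT isT isT isT.
have i2 m2 f2 k2 := inf m2 16 13 16 10 f2 k2 isT isT isT isT.
have i3 m2 f2 k2 := inf m2 10 16 13 16 f2 k2 isT isT isT isT.
have i4 m2 f2 k2 := inf m2 13 16 10 16 f2 k2 isT isT isT isT.
rewrite r10 r13 r16 in i1 i2 i3 i4.
have s1 := @stable_implied (outside t x) _ _ _ _ _ _ xn tn2 xn tn2 xn tn3.
have s2 := @stable_implied (outside t x) _ _ _ _ _ _ xn tn3 xn tn3 xn tn2.
have s3 := @stable_implied (outside t x) _ _ _ _ _ _ tn2 xn tn2 xn tn3 xn.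
have s4 := @stable_implied (outside t x) _ _ _ _ _ _ tn3 xn tn3 xn tn2 xn.
have s34 := stable_and s3 s4; have s234 := stable_and s2 s34.
refine (@spec_weaken n F 18 17 _ (outside_closed t x) (outside_closed t x) m1 isT (fun _ h => h) _).
apply: (@spec_then _ _ 18 _ _ _ _ _ s1 s234 isT f1) => [|m2 f2 k2].
  by apply: i1 => // C cC o; have [-> _] := cl C cC o.
apply: (@spec_then _ _ 18 _ _ _ _ _ s2 s34 isT f2) => [|m3 f3 k3].
  by apply: i2 => // C cC o; have [-> _] := cl C cC o.
have k13 := keep_trans k2 k3; apply: (@spec_then _ _ 18 _ _ _ _ _ s3 s4 isT f3) => [|m4 f4 k4].
  by apply: i3 => // C cC o; have [_ ->] := cl C cC o.
by apply: i4 (keep_trans k13 k4) _ => // C cC o; have [_ ->] := cl C cC o.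
Qed.

Lemma exec_fetch r m A : r != 13 -> 32 <= A -> r < 32 -> m 13 = A -> m 2 = 1 -> r != 2 ->
  let m' := exec [:: ILoad r 13; IAdd 13 13 2] m in
  [/\ m' r = m A, m' 13 = A.+1 & forall a, a != r -> a != 13 -> m' a = m a].
Proof.
move=> /negbTE r13 A32 r32 m13 m2 r2; rewrite /= /upd.
split=> [||a /negbTE-> /negbTE-> //].
  by rewrite r13 eqxx m13.
by rewrite eqxx eq_sym r13 eq_sym (negbTE r2) m13 m2 addn1.
Qed.

(** Register 13 is in turn the pointer fb + 3t, the direction bit d, and t + 1. The rightmost of t
    and t + 1 is t + d and the leftmost is t + 1 - d, which avoids a branch. *)
Lemma exec_load_constraint m t : frame m -> t <= n -> m 10 = t ->
  let m' := exec load_constraint m in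
  [/\ m' 11 = low F t, m' 12 = high F t, m' 13 = t.+1, m' 14 = first_end F t &
      m' 15 = second_end F t] /\
  (forall a, (a < 11) || (32 <= a) -> m' a = m a).
Proof.
move=> fm tn m10; split; last first.
  by move=> a; apply: exec_writes_register.
pose l1 := [:: IAdd 13 10 10; IAdd 13 13 10; IAdd 13 13 1].
pose l4 := [:: ILoad 13 13; IAdd 15 10 13; IAdd 14 10 2; ISub 14 14 13; IAdd 13 10 2].
have -> : load_constraint = l1 ++ [:: ILoad 11 13; IAdd 13 13 2] ++
  [:: ILoad 12 13; IAdd 13 13 2] ++ l4 by [].
rewrite (exec_cat l1) (exec_cat [:: ILoad 11 13; _]) (exec_cat [:: ILoad 12 13; _]).
have E1 a : exec l1 m a = if a == 13 then fb n + 3 * t else m a.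
  rewrite /= /upd /= m10 (frame1 fm); case: (a == 13) => //; lia.
move: (exec l1 m) E1 => m1 E1.
have l := frame_low fm tn; have h := frame_high fm tn; have d := frame_dir fm tn.
have A32 : 32 <= fb n + 3 * t by rewrite /fb; lia.
have out a : 32 <= a -> m1 a = m a by move=> a32; rewrite E1; case: eqP => //; lia.
have e13 : m1 13 = fb n + 3 * t by rewrite E1.
have e10 : m1 10 = t by rewrite E1.
have e2 : m1 2 = 1 by rewrite E1 /= (frame2 fm).
rewrite addn1 in h; rewrite addn2 in d.
move: (fb n + 3 * t) A32 e13 l h d {E1} => A A32 e13.
rewrite -!out; try lia; move=> l h d.
have [g1 g2 g3] := exec_fetch (r := 11) isT A32 isT e13 e2 isT.
move: (exec [:: ILoad 11 13; _] m1) g1 g2 g3 => m2 g1 g2 g3.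
have A32' : 32 <= A.+1 by lia.
have e2' : m2 2 = 1 by rewrite g3.
have [k1 k2 k3] := exec_fetch (r := 12) isT A32' isT g2 e2' isT.
move: (exec [:: ILoad 12 13; _] m2) k1 k2 k3 => m3 k1 k2 k3.
have d3 : m3 A.+2 = (F t).2 by rewrite k3 ?g3 //; lia.
have h3 : m3 12 = high F t by rewrite k1 g3 //; lia.
have l3 : m3 11 = low F t by rewrite k3 // g1.
have t3 : m3 10 = t by rewrite k3 // g3.
have o3 : m3 2 = 1 by rewrite k3.
rewrite /l4 /= /upd /= k2 d3 l3 h3 t3 o3.
by rewrite /first_end /second_end; case: ((F t).2); split=> //=; lia.
Qed.

Definition constraint_closed t (m m' : memory) :=
  rel_of m' 0 t.+1 /\ (rel_of m' t n.+1 /\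
  (rel_of m' (first_end F t) (low F t) /\ (rel_of m' (low F t) (second_end F t) /\
  (rel_of m' (first_end F t) (high F t) /\ (rel_of m' (high F t) (second_end F t) /\
  (forall x, x < n.+2 -> outside_closed t x m m')))))).

Lemma constraint_range t : t <= n ->
  [/\ low F t < n.+2, high F t < n.+2, first_end F t < n.+2 & second_end F t < n.+2].
Proof.
move=> tn; have [b1 [b2 b3]] := F_valid tn.
by rewrite /low /high /first_end /second_end; case: ((F t).2); split; lia.
Qed.

Lemma stable_outside_all t : t <= n ->
  stable (fun m m' => forall x, x < n.+2 -> outside_closed t x m m').
Proof. by move=> tn; apply: stable_all => x xn; apply: stable_outside_closed. Qed.

Lemma stable_constraint_closed t : t <= n -> stable (constraint_closed t).
Proof.
move=> tn; have [b1 b2 b3 b4] := constraint_range tn.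
have tn2 : t < n.+2 by lia.
do 6!(apply: stable_and; first exact: stable_fact).
exact: stable_outside_all.
Qed.

Lemma spec_constraint t m : frame m -> t <= n -> m 10 = t ->
  spec 11 constraint_step (constraint_closed t) m.
Proof.
move=> fm tn m10; rewrite /constraint_step.
have [b1 b2 b3 b4] := constraint_range tn.
have tn2 : t < n.+2 by lia.
have tn3 : t.+1 < n.+2 by lia.
have [[r11 r12 r13 r14 r15] same] := exec_load_constraint fm tn m10.
apply: spec_setup => //; first exact: stable_constraint_closed.
have f1 : frame (exec load_constraint m) by apply: frame_keep fm => a _ ak; apply: same; lia.
have r10 : exec load_constraint m 10 = t by rewrite same.
move: (exec load_constraint m) f1 r10 r11 r12 r13 r14 r15 => m1 f1 r10 r11 r12 r13 r14 r15.
clear same fm m10 m.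
have reg k m2 : keep n 16 m1 m2 -> k < 16 -> m2 k = m1 k.
  by move=> kp k18; apply: kp; [have := rb_geq n; lia|lia].
have mk z w m2 : frame m2 -> keep n 16 m1 m2 -> z < 16 -> w < 16 -> m1 z < n.+2 -> m1 w < n.+2 ->
    (forall C, closed n F C -> C (m1 z) (m1 w)) ->
    spec 16 (Block (mark z w)) (fun _ m' => rel_of m' (m1 z) (m1 w)) m2.
  move=> f2 k2 z16 w16; rewrite -(reg z m2 k2 z16) -(reg w m2 k2 w16) => zn wn imp.
  have z20 : z < 20 by apply: leq_trans z16 _.
  have w20 : w < 20 by apply: leq_trans w16 _.
  exact: spec_weaken (fun _ h => h) (spec_mark f2 z20 w20 zn wn imp).
have k3 : m1 3 = 0 := frame3 f1; have k0 : m1 0 = n.+1 := frame0 f1.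
have i1 m2 f2 k2 := mk 3 13 m2 f2 k2 isT isT.
have i2 m2 f2 k2 := mk 10 0 m2 f2 k2 isT isT.
have i3 m2 f2 k2 := mk 14 11 m2 f2 k2 isT isT.
have i4 m2 f2 k2 := mk 11 15 m2 f2 k2 isT isT.
have i5 m2 f2 k2 := mk 14 12 m2 f2 k2 isT isT.
have i6 m2 f2 k2 := mk 12 15 m2 f2 k2 isT isT.
rewrite k3 k0 r10 r11 r12 r13 r14 r15 in i1 i2 i3 i4 i5 i6.
have s7 := stable_outside_all tn.
have s6 := stable_and (stable_fact b2 b4) s7.
have s5 := stable_and (stable_fact b3 b2) s6.
have s4 := stable_and (stable_fact b1 b4) s5.
have s3 := stable_and (stable_fact b3 b1) s4.
have s2 := stable_and (stable_fact tn2 (ltnSn n.+1)) s3.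
refine (@spec_weaken n F 16 11 _ (constraint_closed t) (constraint_closed t) m1 isT (fun _ h => h) _).
apply: (@spec_then _ _ 16 _ _ _ _ _ (stable_fact (ltn0Sn n.+1) tn3) s2 isT f1) => [|m2 f2 k2].
  by apply: i1 => // C cC; have [] := closed_frame cC tn.
apply: (@spec_then _ _ 16 _ _ _ _ _ (stable_fact tn2 (ltnSn n.+1)) s3 isT f2) => [|m3 f3 k3'].
  by apply: i2 => // C cC; have [] := closed_frame cC tn.
have {}k3' := keep_trans k2 k3'.
apply: (@spec_then _ _ 16 _ _ _ _ _ (stable_fact b3 b1) s4 isT f3) => [|m4 f4 k4].
  by apply: i3 => // C cC; have [] := closed_low cC tn.
have {}k4 := keep_trans k3' k4.
apply: (@spec_then _ _ 16 _ _ _ _ _ (stable_fact b1 b4) s5 isT f4) => [|m5 f5 k5].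
  by apply: i4 => // C cC; have [] := closed_low cC tn.
have {}k5 := keep_trans k4 k5.
apply: (@spec_then _ _ 16 _ _ _ _ _ (stable_fact b3 b2) s6 isT f5) => [|m6 f6 k6].
  by apply: i5 => // C cC; have [] := closed_high cC tn.
have {}k6 := keep_trans k5 k6.
apply: (@spec_then _ _ 16 _ _ _ _ _ (stable_fact b2 b4) s7 isT f6) => [|m7 f7 k7].
  by apply: i6 => // C cC; have [] := closed_high cC tn.
have {}k7 := keep_trans k6 k7.
have e5 : m7 5 = n.+2 := frame5 f7.
have lim : n.+2 <= 3 * n.+1 by lia.
apply: (spec_for e5 lim) => //; first by move=> x xn; apply: stable_outside_closed.
move=> x m8 xn f8 r16 k8.
have {}k8 := keep_trans k7 k8.
exact: (spec_outside f8 tn xn (etrans (reg 10 _ k8 isT) r10) (etrans (reg 11 _ k8 isT) r11)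
  (etrans (reg 12 _ k8 isT) r12) (etrans (reg 13 _ k8 isT) r13) r16).
Qed.

Definition transitive_at x y (m m' : memory) :=
  forall z, z < n.+2 -> implied true x y y z x z m m'.

Definition pair_closed x y (m m' : memory) :=
  implied (x != y) x y y x n.+1 0 m m' /\ transitive_at x y m m'.

Lemma stable_transitive_at x y : x < n.+2 -> y < n.+2 -> stable (transitive_at x y).
Proof. by move=> xn yn; apply: stable_all => z zn; apply: stable_implied. Qed.

Lemma stable_pair_closed x y : x < n.+2 -> y < n.+2 -> stable (pair_closed x y).
Proof.
move=> xn yn; apply: stable_and; last exact: stable_transitive_at.
exact: stable_implied.
Qed.

Lemma spec_pair x y m : frame m -> x < n.+2 -> y < n.+2 -> m 10 = x -> m 11 = y ->
  spec 12 pair_step (pair_closed x y) m.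
Proof.
move=> fm xn yn m10 m11; rewrite /pair_step.
apply: spec_setup => //; first exact: stable_pair_closed.
  by move=> a; apply: exec_writes_register.
set m1 := exec _ m.
have E a : (a < 12) || (32 <= a) -> m1 a = m a by apply: exec_writes_register.
have f1 : frame m1 by apply: frame_keep fm => a _ ak; apply: E; lia.
have r13 : (m1 13 != 0) = (x != y).
  by rewrite /m1 /= /upd /= m10 m11; lia.
have [r10 r11] : m1 10 = x /\ m1 11 = y by rewrite !E.
clearbody m1; clear E fm m10 m11 m.
refine (@spec_weaken n F 12 12 _ (pair_closed x y) (pair_closed x y) m1 isT (fun _ h => h) _).
have s1 := @stable_implied (x != y) _ _ _ _ _ _ xn yn yn xn (ltnSn n.+1) (ltn0Sn n.+1).
apply: (@spec_then _ _ 12 _ _ _ _ _ s1 (stable_transitive_at xn yn) isT f1) => [|m2 f2 k2].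
  have k3 : m1 3 = 0 := frame3 f1; have k0 : m1 0 = n.+1 := frame0 f1.
  have b1 : [&& m1 10 < n.+2, m1 11 < n.+2, m1 11 < n.+2, m1 10 < n.+2, m1 0 < n.+2 & m1 3 < n.+2].
    by rewrite k3 k0 r10 r11 xn yn ltnSn.
  have := @spec_infer n F 10 11 11 10 13 0 3 m1 f1 isT b1.
  rewrite k3 k0 r10 r11 r13 => h; apply: spec_weaken (h _) => // C cC.
  exact: (closed_collapse cC).
have reg k m3 : keep n 12 m1 m3 -> k < 12 -> m3 k = m1 k.
  by move=> kp k18; apply: kp; [have := rb_geq n; lia|lia].
have lim : n.+2 <= 3 * n.+1 by lia.
apply: (spec_for (frame5 f2) lim) => //; first by move=> z zn; apply: stable_implied.
move=> z m3 zn f3 r12 k3; have {}k3 := keep_trans k2 k3.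
have e10 := etrans (reg 10 _ k3 isT) r10; have e11 := etrans (reg 11 _ k3 isT) r11.
have e2 : m3 2 = 1 := frame2 f3.
have b1 : [&& m3 10 < n.+2, m3 11 < n.+2, m3 11 < n.+2, m3 12 < n.+2, m3 10 < n.+2 & m3 12 < n.+2].
  by rewrite r12 e10 e11 xn yn zn.
have := @spec_infer n F 10 11 11 12 2 10 12 m3 f3 isT b1.
rewrite e2 e10 e11 r12 => h; apply: spec_weaken (h _) => // C cC _.
exact: (closed_trans cC).
Qed.

Definition round_closed (m m' : memory) :=
  (forall t, t < n.+1 -> constraint_closed t m m') /\
  (forall x, x < n.+2 -> forall y, y < n.+2 -> pair_closed x y m m').

Lemma stable_pairs x : x < n.+2 -> stable (fun m m' => forall y, y < n.+2 -> pair_closed x y m m').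
Proof. by move=> xn; apply: stable_all => y yn; apply: stable_pair_closed. Qed.

Lemma spec_round m : frame m -> spec 10 saturation_round round_closed m.
Proof.
move=> fm.
have lim1 : n.+1 <= 3 * n.+1 by lia.
have lim2 : n.+2 <= 3 * n.+1 by lia.
have s1 : stable (fun m m' => forall t, t < n.+1 -> constraint_closed t m m').
  by apply: stable_all => t tn; apply: stable_constraint_closed.
have s2 : stable (fun m m' => forall x, x < n.+2 -> forall y, y < n.+2 -> pair_closed x y m m').
  by apply: stable_all => x xn; apply: stable_pairs.
refine (@spec_weaken n F 10 10 _ round_closed round_closed m isT (fun _ h => h) _).
apply: (@spec_then _ _ 10 _ _ _ _ _ s1 s2 isT fm) => [|m1 f1 k1].
  apply: (spec_for (frame0 fm) lim1) => //; first by move=> t tn; apply: stable_constraint_closed.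
  by move=> t m2 tn f2 r10 k2; apply: spec_constraint.
apply: (spec_for (frame5 f1) lim2) => //; first by move=> x; apply: stable_pairs.
move=> x m2 xn f2 r10 k2.
apply: (spec_for (frame5 f2) lim2) => //; first by move=> y yn; apply: stable_pair_closed.
move=> y m3 yn f3 r11 k3; apply: spec_pair => //.
by rewrite k3 //; have := rb_geq n; lia.
Qed.

(** A round derives marks of m' from premises marked in m; if it adds nothing, these conclusions
    already hold in m. *)
Lemma closed_of_round m m' : round_closed m m' ->
    (forall x y, x < n.+2 -> y < n.+2 -> rel_of m' x y -> rel_of m x y) ->
  closed n F (rel_of m).
Proof.
move=> [cc pc] sub; split.
- move=> t tn; have [h1 [h2 _]] := cc t tn; have tn2 : t < n.+2 by lia.
  by split; apply: sub.
- move=> t tn; have [_ [_ [h3 [h4 _]]]] := cc t tn.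
  by have [b1 b2 b3 b4] := constraint_range tn; split; apply: sub.
- move=> t tn; have [_ [_ [_ [_ [h5 [h6 _]]]]]] := cc t tn.
  by have [b1 b2 b3 b4] := constraint_range tn; split; apply: sub.
- move=> t x tn xn out; have [_ [_ [_ [_ [_ [_ h]]]]]] := cc t tn.
  have tn2 : t < n.+2 by lia.
  have [h1 [h2 [h3 h4]]] := h x xn.
  by split; apply/idP/idP => r; apply: sub => //; [apply: h1|apply: h2|apply: h3|apply: h4].
- move=> x y z xn yn zn h1 h2; have [_ h] := pc x xn y yn.
  by apply: sub => //; apply: h.
- move=> x y xn yn xy h1 h2; have [h _] := pc x xn y yn.
  by apply: sub => //; apply: h.
Qed.

Lemma closed_agree (C C' : rel nat) : closed n F C ->
  (forall x y, x < n.+2 -> y < n.+2 -> C x y = C' x y) -> closed n F C'.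
Proof.
move=> cC e; have n0 : 0 < n.+2 by [].
split.
- move=> t tn; have [h1 h2] := closed_frame cC tn.
  by rewrite -!e //; lia.
- move=> t tn; have [h1 h2] := closed_low cC tn.
  by have [b1 b2 b3 b4] := constraint_range tn; rewrite -!e.
- move=> t tn; have [h1 h2] := closed_high cC tn.
  by have [b1 b2 b3 b4] := constraint_range tn; rewrite -!e.
- move=> t x tn xn out; have [h1 h2] := closed_outside cC tn xn out.
  have tn2 : t < n.+2 by lia.
  by rewrite -!e.
- by move=> x y z xn yn zn; rewrite -!e //; apply: (closed_trans cC).
- by move=> x y xn yn xy; rewrite -!e //; apply: (closed_collapse cC).
Qed.

(** * Counting the rounds *)

Definition pairs := [seq (x, y) | x <- iota 0 n.+2, y <- iota 0 n.+2].
Definition marked (m : memory) (p : nat * nat) := rel_of m p.1 p.2.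

Lemma mem_pairs x y : ((x, y) \in pairs) = (x < n.+2) && (y < n.+2).
Proof.
apply/allpairsP/andP => [[[u v] [+ + [-> ->]]]|[xn yn]]; first by rewrite !mem_iota.
by exists (x, y); rewrite !mem_iota.
Qed.

Lemma count_leq_in (T : eqType) (a b : pred T) (s : seq T) :
  {in s, forall q, a q -> b q} -> count a s <= count b s.
Proof.
elim: s => [//|q s IH] ab /=; apply: leq_add.
  by have := ab q (mem_head _ _); case: (a q) => // ->.
by apply: IH => r rs; apply: ab; rewrite inE rs orbT.
Qed.

Lemma count_ltn_in (T : eqType) (a b : pred T) (s : seq T) p :
  {in s, forall q, a q -> b q} -> p \in s -> b p -> ~~ a p -> count a s < count b s.
Proof.
elim: s => [//|q s IH] ab + bp ap /=.
have abs : {in s, forall q, a q -> b q} by move=> r rs; apply: ab; rewrite inE rs orbT.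
rewrite inE => /orP[/eqP<-|ps].
  by rewrite bp (negbTE ap) add0n add1n ltnS; apply: count_leq_in.
have := IH abs ps bp ap; have := ab q (mem_head _ _).
by case: (a q) => [->//|_]; case: (b q) => //; rewrite ?add0n ?add1n // => /ltnW.
Qed.

(* Each round marks a new pair unless S is already closed, hence the number of rounds. *)
Definition progress c m := closed n F (rel_of m) \/ c <= count (marked m) pairs.

Lemma marked_extends m m' : extends m m' -> {in pairs, forall p, marked m p -> marked m' p}.
Proof. by move=> [e _] [x y]; rewrite mem_pairs => /andP[xn yn]; apply: e. Qed.

Lemma closed_extends m m' : extends m m' -> closed n F (rel_of m) -> closed n F (rel_of m').
Proof.
move=> [e1 e2] c; apply: (closed_agree c) => x y xn yn; apply/idP/idP; first exact: e1.
by apply: (e2 _ c).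
Qed.

Lemma progress_extends c m m' : extends m m' -> progress c m -> progress c m'.
Proof.
move=> e [h|h]; first by left; apply: closed_extends e h.
by right; apply: leq_trans h _; apply: count_leq_in; apply: marked_extends.
Qed.

Lemma progress_round c m m' : extends m m' -> round_closed m m' -> progress c m ->
  progress c.+1 m'.
Proof.
move=> e r [h|h]; first by left; apply: closed_extends e h.
case sub: (all (fun p => marked m' p ==> marked m p) pairs).
  left; apply: (closed_extends e); apply: (closed_of_round r) => x y xn yn.
  by have /allP/(_ (x, y)) := sub; rewrite mem_pairs xn yn => /(_ isT)/implyP.
right; apply: leq_ltn_trans h _.
have [p pp] : exists2 p, p \in pairs & ~~ (marked m' p ==> marked m p).
  by apply/allPn; rewrite sub.
by rewrite negb_imply => /andP[p1 p2]; apply: count_ltn_in p1 p2 => //; apply: marked_extends.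
Qed.

(** If the count reaches the number of all pairs, the relation is total, and the total relation
    satisfies every rule. *)
Lemma progress_closed m : progress (n.+2 * n.+2) m -> closed n F (rel_of m).
Proof.
case=> // h; have sz : size pairs = n.+2 * n.+2 by rewrite size_allpairs !size_iota.
have al : all (marked m) pairs by rewrite all_count eqn_leq count_size sz.
have full x y : x < n.+2 -> y < n.+2 -> rel_of m x y.
  by move=> xn yn; have /allP/(_ (x, y)) := al; rewrite mem_pairs xn yn; apply.
apply: (@closed_agree (fun _ _ => true)); first by [].
by move=> x y xn yn; rewrite full.
Qed.

Lemma spec_saturate m : frame m -> spec 8 saturate (fun _ m' => closed n F (rel_of m')) m.
Proof.
move=> fm.
have lim m1 : frame m1 -> m1 5 <= 3 * n.+1 by move=> f1; rewrite (frame5 f1); lia.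
have e5 := frame5 fm.
(* Counters run downwards: with i outer iterations left, (n + 2 - i)(n + 2) rounds have been
   completed. *)
have s1 (i : nat) m1 m2 : extends m1 m2 -> progress ((n.+2 - i) * n.+2) m1 ->
    progress ((n.+2 - i) * n.+2) m2 by apply: progress_extends.
have p0 : progress ((n.+2 - m 5) * n.+2) m by right; rewrite e5 subnn.
have it := @spec_iter n F 8 5 (For 9 5 saturation_round) _ m s1 isT isT (lim _ fm) fm p0.
apply: (spec_weaken (leqnn 8) _ (it _)) => [m' p|i m1 il f1 r8 k1 p1].
  by apply: progress_closed; move: p; rewrite subn0.
rewrite e5 in il.
have s2 j m2 m3 : extends m2 m3 -> progress ((n.+2 - i.+1) * n.+2 + (n.+2 - j)) m2 ->
    progress ((n.+2 - i.+1) * n.+2 + (n.+2 - j)) m3 by apply: progress_extends.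
have p2 : progress ((n.+2 - i.+1) * n.+2 + (n.+2 - m1 5)) m1.
  by rewrite (frame5 f1) subnn addn0.
have it2 := @spec_iter n F 9 5 saturation_round _ m1 s2 isT isT (lim _ f1) f1 p2.
apply: (spec_weaken (leqnn 9) _ (it2 _)) => [m'|j m2 jl f2 r9 k2 p3].
  by rewrite subn0 -mulSnr -subSn.
rewrite (frame5 f1) in jl.
have [m3 [run3 k3 e3 q3]] := spec_round f2.
exists m3; split=> //.
by have := progress_round e3 q3 p3; rewrite -addnS -subSn.
Qed.

End Saturation.

(** * Memory initialization and the decision program *)

Definition save_cells a k := flatten [seq [:: IAdd 1 1 2; IStore 1 b] | b <- iota a k].

(* The input occupies the low cells: cells 2 to 9 are first saved to free some
   registers, a loop then copies the rest of the input.  Cell 1 is free from the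
   start, because the first entry of a profile is 0. *)
Definition relocate_start :=
  IConst 1 64 :: nseq 8 (IAdd 1 1 0) ++ [:: IStore 1 2; IConst 2 1] ++ save_cells 3 7 ++
  [:: IConst 3 0; IConst 4 9; ISub 1 1 4; IConst 4 10; IAdd 5 0 0; IAdd 5 5 0].

Definition relocate_rest := For 6 5 (Block [:: IAdd 7 6 4; ILoad 8 7; IAdd 7 7 1; IStore 7 8]).

Definition set_registers :=
  [:: IAdd 4 0 0; IAdd 4 4 0; IAdd 1 1 2; IAdd 4 4 1; IAdd 4 4 2; IAdd 4 4 2; IAdd 4 4 2;
      IAdd 0 0 2; IAdd 5 0 2; IAdd 6 4 5].

Definition fill_table := For 8 5 (Block [:: IAdd 9 4 8; IStore 9 6; IAdd 6 6 5]).

Definition answer := locate 21 0 3 ++ [:: ILoad 21 21; ISub 0 2 21].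

Definition decide :=
  Then (Block relocate_start) (Then relocate_rest (Then (Block set_registers)
  (Then fill_table (Then saturate (Block answer))))).

Lemma exec_save_cells k m : m 2 = 1 -> 32 <= m 1 -> k <= 20 ->
  forall b, exec (save_cells 3 k) m b =
    if b == 1 then m 1 + k else if m 1 < b <= m 1 + k then m (b - m 1 + 2) else m b.
Proof.
move=> m2 m1; elim: k => [|k IH] k20 b.
  by rewrite addn0 /=; case: eqP => [->//|_]; case: ifP => //; lia.
rewrite /save_cells -[k.+1]addn1 iotaD map_cat flatten_cat -/(save_cells 3 k) exec_cat.
have {}IH := IH (ltnW k20); move: (exec _ m) IH => m' IH.
have e1 : m' 1 = m 1 + k by rewrite IH.
have e2 : m' 2 = 1 by rewrite IH /=; case: ifP => //; lia.
have ek : m' (3 + k) = m (3 + k).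
  rewrite IH; have -> : (3 + k == 1) = false by lia.
  have -> // : (m 1 < 3 + k <= m 1 + k) = false by lia.
rewrite /= /upd /= e1 e2 ek.
case: (b =P m 1 + k + 1) => [->|ne].
  by do !(case: ifP => ?; try lia); congr m; lia.
by rewrite IH; do !(case: ifP => ?; try lia).
Qed.

Lemma exec_nseq_add k m b :
  exec (nseq k (IAdd 1 1 0)) m b = if b == 1 then m 1 + k * m 0 else m b.
Proof.
elim: k m => [|k IH] m; first by rewrite mul0n addn0 /=; case: eqP => [->|].
rewrite [LHS](IH (upd m 1 (m 1 + m 0))) /upd /=; case: (b == 1) => //.
by rewrite mulSn addnA.
Qed.

Section Encoding.

Variables (n : nat) (F : profile).
Hypotheses (n_gt0 : 0 < n) (F_valid : valid_profile n F).

Definition input a := nth 0 (encode n F) a.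

Lemma size_encode : size (encode n F) = 3 * n + 4.
Proof.
rewrite /encode /=; have H k : size (flatten
    [seq [:: (F t).1.1; (F t).1.2; nat_of_bool (F t).2] | t <- iota k n.+1]) = 3 * n.+1.
  by elim: n.+1 k => [//|N IH] k /=; rewrite IH; lia.
by have /= -> := H 0; lia.
Qed.

Lemma input_cells t : t <= n ->
  [/\ input (1 + 3 * t) = low F t, input (1 + 3 * t + 1) = high F t &
      input (1 + 3 * t + 2) = (F t).2].
Proof.
rewrite /input /encode -ltnS.
have H k N : t < N -> let s := flatten
    [seq [:: (F u).1.1; (F u).1.2; nat_of_bool (F u).2] | u <- iota k N] in
    [/\ nth 0 s (3 * t) = low F (k + t), nth 0 s (3 * t + 1) = high F (k + t) &
      nth 0 s (3 * t + 2) = (F (k + t)).2].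
  elim: t k N => [|t IH] k [//|N] tN; first by rewrite addn0.
  have -> : 3 * t.+1 = (3 * t).+3 by lia.
  by rewrite addnS -addSn; apply: IH.
by move=> /(H 0); rewrite !add1n.
Qed.

Lemma input0 : input 0 = n. Proof. by []. Qed.

Lemma input1 : input 1 = 0.
Proof.
have [] := input_cells (leq0n n); rewrite muln0 addn0 => -> _ _.
by have [h _] := F_valid (leq0n n); rewrite /low; lia.
Qed.

Lemma input_beyond a : 3 * n + 4 <= a -> input a = 0.
Proof. by move=> h; rewrite /input nth_default // size_encode. Qed.

(** Input cell a moves to 8n + 62 + a. The pointer starts at 8n + 64, the image of cell 2, advances
    by 7 for cells 3 to 9, and drops by 9 to leave the offset. Cells past the input are 0 and count
    as copied. *)
Lemma exec_relocate_start : let m := exec relocate_start input in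
  [/\ m 0 = n, m 1 = 8 * n + 62, m 2 = 1, m 3 = 0 & m 4 = 10] /\
  [/\ m 5 = 3 * n,
      forall a, 10 <= a <= 8 * n + 62 -> m a = input a &
      forall a, 0 < a -> (a < 10) || (3 * n + 10 <= a) -> m (8 * n + 62 + a) = input a].
Proof.
pose l1 := IConst 1 64 :: nseq 8 (IAdd 1 1 0) ++ [:: IStore 1 2; IConst 2 1].
pose l3 := [:: IConst 3 0; IConst 4 9; ISub 1 1 4; IConst 4 10; IAdd 5 0 0; IAdd 5 5 0].
have -> : relocate_start = l1 ++ save_cells 3 7 ++ l3 by [].
rewrite (exec_cat l1) (exec_cat (save_cells 3 7)).
have E1 a : exec l1 input a = if a == 2 then 1 else if a == 8 * n + 64 then input 2 else
    if a == 1 then 8 * n + 64 else input a.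
  have E0 b : exec (IConst 1 64 :: nseq 8 (IAdd 1 1 0)) input b =
      if b == 1 then 8 * n + 64 else input b.
    rewrite [LHS](exec_nseq_add 8 (upd input 1 64)) /upd /= input0.
    by case: (b == 1) => //; lia.
  rewrite (exec_cat (IConst 1 64 :: nseq 8 _)); move: (exec (IConst _ _ :: _) input) E0 => m0 E0.
  by rewrite /= /upd !E0 /=.
move: (exec l1 input) E1 => m1 E1.
have e1 : m1 1 = 8 * n + 64 by rewrite E1 /=; case: ifP => //; lia.
have e2 : m1 2 = 1 by rewrite E1.
have E2 := @exec_save_cells 7 m1 e2; rewrite e1 in E2.
have {}E2 := E2 _ isT; move: (exec _ m1) E2 => m2 E2.
have {}E2 := E2 (leq_trans _ (leq_addl _ _)).
have {}E2 b : m2 b = if b == 1 then 8 * n + 64 + 7 else if b == 2 then 1 else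
    if 8 * n + 64 <= b <= 8 * n + 71 then input (b - (8 * n + 62)) else input b.
  rewrite E2 // !E1; do !(case: ifP => ?; try lia) => //; congr input; lia.
have f0 : m2 0 = n by rewrite E2 /= input0; case: ifP => //; lia.
have f1 : m2 1 = 8 * n + 64 + 7 by rewrite E2.
have f2 : m2 2 = 1 by rewrite E2.
have E3 a : 6 <= a -> exec l3 m2 a = m2 a.
  by move=> a6; rewrite /= /upd; do !(case: eqP => [?|_]; first lia).
split; first by rewrite /= /upd /= f0 f1 f2; split=> //; lia.
split; first by rewrite /= /upd /= f0; lia.
  by move=> a ha; rewrite E3 ?E2; [do !(case: ifP => ?; try lia)|lia].
move=> a a0 ha; rewrite E3 ?E2; last lia.
case: (a =P 1) => [->|a1].
  by rewrite input1; do !(case: ifP => ?; try lia); rewrite input_beyond //; lia.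
do !(case: ifP => ?; try lia); first by congr input; lia.
by rewrite !input_beyond //; lia.
Qed.

Lemma exec_copy m u v b : m 6 + m 4 = u -> u + m 1 = v -> 32 <= v -> 10 <= u ->
  exec [:: IAdd 7 6 4; ILoad 8 7; IAdd 7 7 1; IStore 7 8] m b =
    if b == v then m u else if b == 7 then v else if b == 8 then m u else m b.
Proof.
move=> eu ev v32 u10; rewrite /= /upd /= eu ev.
have -> : (u == 7) = false by lia.
by case: (b == v); case: (b =P 7); case: (b =P 8).
Qed.

(** The loop copies cells 10 to 3n + 9, running a little beyond the input into zeros. Every target
    lies above 8n + 62, so no source is overwritten. *)
Lemma runs_relocate_rest m : [/\ m 0 = n, m 1 = 8 * n + 62, m 2 = 1, m 3 = 0 & m 4 = 10] ->
    [/\ m 5 = 3 * n, forall a, 10 <= a <= 8 * n + 62 -> m a = input a &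
      forall a, 0 < a -> (a < 10) || (3 * n + 10 <= a) -> m (8 * n + 62 + a) = input a] ->
  exists2 m', runs (3 * n.+1) relocate_rest m m' &
    [/\ m' 0 = n, m' 1 = 8 * n + 62, m' 2 = 1, m' 3 = 0 &
        forall a, 0 < a -> m' (8 * n + 62 + a) = input a].
Proof.
move=> [m0 m1 m2 m3 m4] [m5 src dst].
pose I i (m : memory) := [/\ m 0 = n, m 1 = 8 * n + 62, m 2 = 1, m 3 = 0 & m 4 = 10] /\
  [/\ m 6 = i, forall a, 10 <= a <= 8 * n + 62 -> m a = input a &
    forall a, 0 < a -> (a < 10) || (i + 10 <= a) -> m (8 * n + 62 + a) = input a].
have [||||m' run' [[e0 e1 e2 e3 e4] [_ _ dst']]] := @runs_for (3 * n.+1) 6 5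
  (Block [:: IAdd 7 6 4; ILoad 8 7; IAdd 7 7 1; IStore 7 8]) I m.
- by rewrite m5; lia.
- by move=> i k [[e0 e1 e2 e3 e4] [e6 _ _]].
- have E a : exec_instr (IAdd 6 5 3) m a = if a == 6 then 3 * n else m a.
    by rewrite /= /upd m5 m3 addn0.
  move: (exec_instr _ m) E => k E; split; first by rewrite !E.
  rewrite !E m5; split=> // a; rewrite ?E => ha.
    by rewrite ifF; [apply: src|lia].
  by move=> ha'; rewrite ifF; [apply: dst|lia].
- rewrite m5 => i k il [[e0 e1 e2 e3 e4] [e6 s d]].
  have E a : exec_instr (ISub 6 6 2) k a = if a == 6 then i else k a.
    by rewrite /= /upd e6 e2 subn1.
  move: (exec_instr (ISub 6 6 2) k) E => k1 E.
  have eu : k1 6 + k1 4 = i + 10 by rewrite !E /= e4.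
  have ev : i + 10 + k1 1 = 8 * n + 62 + (i + 10) by rewrite E /= e1 addnC.
  have v32 : 32 <= 8 * n + 62 + (i + 10) by lia.
  have u10 : 10 <= i + 10 by lia.
  exists (exec [:: IAdd 7 6 4; ILoad 8 7; IAdd 7 7 1; IStore 7 8] k1); first exact: runs_block.
  have E2 b := exec_copy b eu ev v32 u10.
  move: (exec _ k1) E2 => k2 E2.
  have lowE b : b < 32 -> k2 b = if b == 7 then 8 * n + 62 + (i + 10) else
      if b == 8 then k1 (i + 10) else k1 b.
    by move=> b32; rewrite E2; have -> : (b == 8 * n + 62 + (i + 10)) = false by lia.
  split; first by rewrite !lowE // !E.
  split=> [|a ha|a a0 ha]; first by rewrite lowE //= E.
    by rewrite E2 !E; do !(case: ifP => ?; try lia); apply: s.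
  rewrite E2; case: (a =P i + 10) => [->|ne].
    by rewrite eqxx E ifF; [apply: s; lia|lia].
  by rewrite !E; do !(case: ifP => ?; try lia); apply: d; lia.
by exists m' => //; split=> // a a0; apply: dst'; lia.
Qed.

Lemma exec_set_registers m : [/\ m 0 = n, m 1 = 8 * n + 62, m 2 = 1 & m 3 = 0] ->
  let m' := exec set_registers m in
  [/\ m' 0 = n.+1, m' 1 = fb n, m' 2 = 1 & m' 3 = 0] /\
  [/\ m' 4 = tb n, m' 5 = n.+2, m' 6 = rb n & forall a, 32 <= a -> m' a = m a].
Proof.
move=> [m0 m1 m2 m3].
have keep_high a : 32 <= a -> exec set_registers m a = m a.
  by move=> ha; apply: (@exec_writes_register 0) => //; rewrite ha orbT.
move: keep_high.
pose l1 := [:: IAdd 4 0 0; IAdd 4 4 0; IAdd 1 1 2; IAdd 4 4 1].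
pose l2 := [:: IAdd 4 4 2; IAdd 4 4 2; IAdd 4 4 2].
pose l3 := [:: IAdd 0 0 2; IAdd 5 0 2; IAdd 6 4 5].
have -> : set_registers = l1 ++ l2 ++ l3 by [].
rewrite (exec_cat l1) (exec_cat l2).
have [p0 [p1 [p2 [p3 p4]]]] : exec l1 m 0 = n /\ exec l1 m 1 = fb n /\
    exec l1 m 2 = 1 /\ exec l1 m 3 = 0 /\ exec l1 m 4 = fb n + 3 * n.
  by rewrite /= /upd /= m0 m1 m2 m3 /fb; do !split; lia.
move: (exec l1 m) p0 p1 p2 p3 p4 => k p0 p1 p2 p3 p4.
have [q0 [q1 [q2 [q3 q4]]]] : exec l2 k 0 = n /\ exec l2 k 1 = fb n /\
    exec l2 k 2 = 1 /\ exec l2 k 3 = 0 /\ exec l2 k 4 = tb n.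
  by rewrite /= /upd /= p0 p1 p2 p3 p4 /tb; do !split; lia.
move: (exec l2 k) q0 q1 q2 q3 q4 => j q0 q1 q2 q3 q4.
have [r0 [r1 [r2 [r3 [r4 [r5 r6]]]]]] : exec l3 j 0 = n.+1 /\ exec l3 j 1 = fb n /\
    exec l3 j 2 = 1 /\ exec l3 j 3 = 0 /\ exec l3 j 4 = tb n /\
    exec l3 j 5 = n.+2 /\ exec l3 j 6 = rb n.
  by rewrite /= /upd /= q0 q1 q2 q3 q4 /rb; do !split; lia.
by [].
Qed.

Lemma exec_table_entry m u b : m 4 + m 8 = u -> 32 <= u ->
  exec [:: IAdd 9 4 8; IStore 9 6; IAdd 6 6 5] m b =
    if b == 6 then m 6 + m 5 else if b == u then m 6 else if b == 9 then u else m b.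
Proof.
move=> eu u32; rewrite /= /upd /= eu.
have -> : (6 == u) = false by lia.
by have -> : (5 == u) = false by lia.
Qed.

Lemma runs_fill_table m : [/\ m 0 = n.+1, m 1 = fb n, m 2 = 1 & m 3 = 0] ->
    [/\ m 4 = tb n, m 5 = n.+2, m 6 = rb n & forall a, tb n <= a -> m a = 0] ->
    (forall t, t <= n -> [/\ m (fb n + 3 * t) = low F t, m (fb n + 3 * t + 1) = high F t &
      m (fb n + 3 * t + 2) = (F t).2]) ->
  exists2 m', runs (3 * n.+1) fill_table m m' &
    frame n F m' /\ forall a, rb n <= a -> m' a = 0.
Proof.
move=> [m0 m1 m2 m3] [m4 m5 m6 z] prof.
have fb32 : 32 <= fb n by rewrite /fb; lia.
have fbtb : fb n + (3 * n + 3) = tb n by [].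
have tbrb : tb n + n.+2 = rb n by [].
pose I i (k : memory) := [/\ k 0 = n.+1, k 1 = fb n, k 2 = 1, k 3 = 0 & k 4 = tb n] /\
  [/\ k 5 = n.+2, k 6 = rb n + (n.+2 - i) * n.+2 & k 8 = i] /\
  [/\ forall x, i <= x < n.+2 -> k (tb n + x) = row n x,
      forall a, 32 <= a < tb n -> k a = m a & forall a, rb n <= a -> k a = 0].
have [||||m' run' [[e0 e1 e2 e3 e4] [[e5 _ _] [tab old zero]]]] := @runs_for (3 * n.+1) 8 5
  (Block [:: IAdd 9 4 8; IStore 9 6; IAdd 6 6 5]) I m.
- by rewrite m5; lia.
- by move=> i k [[e0 e1 e2 e3 e4] [[_ _ e8] _]].
- have E a : exec_instr (IAdd 8 5 3) m a = if a == 8 then n.+2 else m a.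
    by rewrite /= /upd m5 m3 addn0.
  move: (exec_instr _ m) E => k E; split; first by rewrite !E.
  split; first by rewrite !E /= m5 m6 subnn mul0n addn0.
  rewrite m5; split=> [x|a ha|a ha]; first lia.
    by rewrite E ifF //; lia.
  by rewrite E ifF; [apply: z|]; lia.
- rewrite m5 => i k il [[e0 e1 e2 e3 e4] [[e5 e6 e8] [tab old zero]]].
  have E a : exec_instr (ISub 8 8 2) k a = if a == 8 then i else k a.
    by rewrite /= /upd e8 e2 subn1.
  move: (exec_instr (ISub 8 8 2) k) E => k1 E.
  have eu : k1 4 + k1 8 = tb n + i by rewrite !E /= e4.
  have u32 : 32 <= tb n + i by lia.
  exists (exec [:: IAdd 9 4 8; IStore 9 6; IAdd 6 6 5] k1); first exact: runs_block.
  have E2 b := exec_table_entry b eu u32.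
  move: (exec _ k1) E2 => k2 E2.
  have e61 : k1 6 = rb n + (n.+2 - i.+1) * n.+2 by rewrite E.
  have e51 : k1 5 = n.+2 by rewrite E.
  rewrite e61 e51 in E2.
  have same b : b != 6 -> b != tb n + i -> b != 9 -> b != 8 -> k2 b = k b.
    by move=> /negbTE h1 /negbTE h2 /negbTE h3 /negbTE h4; rewrite E2 h1 h2 h3 E h4.
  split; first by rewrite !same //; lia.
  split; first split.
  + by rewrite same //; lia.
  + by rewrite E2 eqxx subSS -addnA addnC -[_ + n.+2]mulSnr -subSn // addnC.
  + by rewrite E2 !ifF ?E //; lia.
  split=> [x ix|a ha|a ha].
  + case: (x =P i) => [->|xi]; first by rewrite E2 ifF ?eqxx ?subSS //; lia.
    by rewrite same; [apply: tab|..]; lia.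
  + by rewrite same; [apply: old|..]; lia.
  + by rewrite same; [apply: zero|..]; lia.
exists m' => //; split=> //.
split=> // t tn; have [p1 p2 p3] := prof t tn.
- by rewrite old //; lia.
- by rewrite old //; lia.
- by rewrite old //; lia.
Qed.

Lemma runs_decide : linear_profile n F ->
  exists2 m', runs (3 * n.+1) decide input m' & (m' 0 != 0 <-> realizable n F).
Proof.
move=> F_linear.
have [a1 a2] := exec_relocate_start.
have [m2 run2 [b0 b1 b2 b3 bd]] := runs_relocate_rest a1 a2.
have [c1 [c4 c5 c6 c7]] := exec_set_registers (And4 b0 b1 b2 b3).
have run3 := @runs_block (3 * n.+1) set_registers m2 isT.
move: (exec set_registers m2) c1 c4 c5 c6 c7 run3 => m3 c1 c4 c5 c6 c7 run3.
have fb_off a : 32 <= 8 * n + 62 + a by lia.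
have data a : 0 < a -> m3 (8 * n + 62 + a) = input a by move=> a0; rewrite c7 // bd.
have zero a : tb n <= a -> m3 a = 0.
  move=> ha; have -> : a = 8 * n + 62 + (a - (8 * n + 62)) by move: ha; rewrite /tb /fb; lia.
  by rewrite data ?input_beyond //; move: ha; rewrite /tb /fb; lia.
have prof t : t <= n -> [/\ m3 (fb n + 3 * t) = low F t,
    m3 (fb n + 3 * t + 1) = high F t & m3 (fb n + 3 * t + 2) = (F t).2].
  move=> tn; have [<- <- <-] := input_cells tn.
  by rewrite -!data // /fb; split; congr m3; lia.
have [m4 run4 [f4 z4]] := runs_fill_table c1 (And4 c4 c5 c6 zero) prof.
have [m5 [run5 k5 [_ e5] cl]] := spec_saturate F_valid f4.
have f5 : frame n F m5 by apply: frame_keep f4; apply: keep_leq k5.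
have run6 := @runs_block (3 * n.+1) answer m5 isT.
exists (exec answer m5).
  do 4!(apply: runs_then; first eassumption || exact: runs_block).
  by apply: runs_then run5 run6.
have e0 : m5 0 = n.+1 := frame0 f5; have e3 : m5 3 = 0 := frame3 f5.
have n1 : m5 0 < n.+2 by rewrite e0.
have L a := exec_locate (d := 21) a f5 isT (x := 0) (y := 3) isT isT n1.
have -> : exec answer m5 0 = 1 - m5 (addr n n.+1 0).
  rewrite /answer (exec_cat (locate 21 0 3)); rewrite e0 e3 in L.
  move: (exec (locate 21 0 3) m5) L => k L.
  have k21 : k 21 = addr n n.+1 0 by rewrite L.
  have k2 : k 2 = 1 by rewrite L /= (frame2 f5).
  rewrite /= /upd /= k21 k2 L; congr (_ - _).
  by rewrite ifF //; have := addr_geq n n.+1 0; have := rb_geq n; lia.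
rewrite (realizableP n_gt0 F_valid F_linear cl).
  by rewrite /rel_of negbK; case: (m5 _).
(* Saturation started from the empty relation, which every closed C contains, so the result is the
   least closed relation. *)
move=> C cC; apply: e5 => // x y _ _; rewrite /rel_of z4 //; exact: addr_geq.
Qed.

End Encoding.

Theorem theorem1 :
  exists (p : program) (c d : nat),
    forall (n : nat) (F : profile),
      0 < n -> valid_profile n F -> linear_profile n F ->
      exists st : state,
        run p (c * n.+1 ^ d) (init (encode n F)) = Some st /\
        (output st <-> realizable n F).
Proof.
have [a [d ad]] := cost_poly decide.
(* The cost is polynomial in the loop bound 3(n + 1); the factor 3 is moved into the constant as
   [3 ^ d]. *)
exists (compile 0 decide), (a * 3 ^ d), d => n F n0 Fv Fl.
have [m' run' dec] := runs_decide n0 Fv Fl.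
have [|st hst stm] := run_cmd (fuel := a * 3 ^ d * n.+1 ^ d) run'.
  by rewrite -mulnA -expnMn; apply: ad; lia.
by exists st; split=> //; rewrite /output stm.
Qed.
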